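(* Let $\{f_n\}_{n=1}^\infty$ be an orthonormal sequence of random variables on a probability space $(\Omega,\Sigma,\mathbb P)$ with $|f_n(\omega)|\le D$ for all $n$ and $\omega$. Then it contains a subsequence $\{\varphi_i\}_{i=1}^\infty$ equivalent in distribution to the Rademacher system, with a constant of equivalence depending only on $D$.
   Context: The Rademacher system is $r_n(x)=\operatorname{sign}\sin(2^{n-1}\pi x)$ on $[0,1]$ with Lebesgue measure. Equivalence in distribution $\{f_n\}\stackrel{\mathbb P}{\sim}\{g_n\}$: there is $C>0$ such that for all $m$, real $a_1,\dots,a_m$ and $z>0$, $C^{-1}\mathbb P\{|\sum_{n=1}^m a_nf_n|>Cz\}\le\mathbb P'\{|\sum_{n=1}^m a_ng_n|>z\}\le C\,\mathbb P\{|\sum_{n=1}^m a_nf_n|>C^{-1}z\}$. *)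

(* Defs.v *)
From HB Require Import structures.
From mathcomp Require Import all_boot all_order all_algebra.
From mathcomp Require Import all_classical all_reals all_analysis.
Set Implicit Arguments. Unset Strict Implicit. Unset Printing Implicit Defensive.
Import Order.TTheory GRing.Theory Num.Theory.
Local Open Scope classical_set_scope.
Local Open Scope ring_scope.

Definition rademacher {R : realType} (n : nat) (x : R) : R :=
  Num.sg (sin (2 ^+ n.-1 * pi * x)).

Definition rad_tail {R : realType} (m : nat) (a : nat -> R) (z : R) : \bar R :=
  (@lebesgue_measure R)
    ([set x : R | 0 <= x <= 1 /\ z < `| \sum_(i < m) a i * rademacher i.+1 x |]).

Definition seq_tail {d} {T : measurableType d} {R : realType}
  (P : probability T R) (g : nat -> T -> R) (m : nat) (a : nat -> R) (z : R)
  : \bar R :=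
  P [set w | z < `| \sum_(i < m) a i * g i w |].

Definition equiv_dist_rademacher {d} {T : measurableType d} {R : realType}
  (P : probability T R) (g : nat -> T -> R) (C : R) : Prop :=
  0 < C /\
  forall (m : nat) (a : nat -> R) (z : R), 0 < z ->
    ((C^-1)%:E * seq_tail P g m a (C * z) <= rad_tail m a z)%E /\
    (rad_tail m a z <= C%:E * seq_tail P g m a (C^-1 * z))%E.

Definition orthonormal_seq {d} {T : measurableType d} {R : realType}
  (P : probability T R) (f : nat -> T -> R) : Prop :=
  (forall n, measurable_fun setT (f n)) /\
  (forall n m, (\int[P]_w (f n w * f m w)%:E = (n == m)%:R%:E)%E).

(* Main.v *)
Require Import Defs.
From HB Require Import structures.
From mathcomp Require Import all_boot all_order all_algebra.
From mathcomp Require Import all_classical all_reals all_analysis.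
From mathcomp Require Import measurable_realfun ring lra zify.
Import Order.TTheory GRing.Theory Num.Theory.
Local Open Scope classical_set_scope.
Local Open Scope ring_scope.

(* Write S = \sum a_i phi_i and R = \sum a_i r_i. It suffices to compare the even moments of S
   and R within factors A^2k: since E R^4k <= 16^k (E R^2k)^2, the Markov and Paley-Zygmund
   inequalities turn such a comparison into one of tails.

   By Bessel's inequality one can select phi_n = f_sigma(n) so that phi_n is almost orthogonal
   to all g and all phi_j^2 g (j > n), where g runs over the finitely many products of earlier
   factors phi_i^e (1 +- phi_i / D). The Riesz product K = \prod (1 + phi_i r_i / D) is then a
   nonnegative kernel, with mean 1 in the signs and mean at most 2 in omega. Integrating
   K R over the signs gives S / D, so E S^2k <= 2 D^2k E R^2k by Jensen. Integrating K S over
   omega gives R / D up to errors that the contraction principle absorbs into E R^2k, whence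
   the reverse comparison. *)

(** The factor of index j of the Riesz product contributes E (phi_j^2 Q_j) to the mean of phi_j K,
    where Q_j is the product of the factors below j, and orthonormality controls only the mean of
    phi_j^2. Expanding Q_j back to 1 leaves terms E (phi_i phi_j^2 Q_i) with i < j. Hence phi_i is
    tested against squares of functions picked later, and after each pick an infinite reservoir of
    indices passing these tests must survive.

    The comparison of moments may lose only a factor A^2k, for all k at once. So R is written as a
    convex combination with weights 2^-(n+1): the main term has weight 1/2, and the errors, even
    after division by their weights, have moments at most E R^2k, so that half of E R^2k moves to
    the left side. This dictates the decay 4^-n of the tolerances.

    The bound on E R^4k holds because the moments of R over factorials are the coefficients of a
    product of the series of cosh (a_i x), and submultiplicativity of coefficients survives such
    products. S inherits a bound of this kind from R through the comparison of moments. *)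

(* Common to averages over signs and to integrals of bounded measurable functions ([adm]),
   so that Jensen, Markov and Paley-Zygmund are proved only once. *)
Structure expectation_on (R : realType) (T : Type) := ExpectationOn {
  adm : (T -> R) -> Prop;
  ex : (T -> R) -> R;
  adm_cst : forall c, adm (fun=> c);
  admD : forall f g, adm f -> adm g -> adm (fun w => f w + g w);
  admM : forall f g, adm f -> adm g -> adm (fun w => f w * g w);
  adm_pos : forall f, adm f -> adm (fun w => (0 < f w)%R%:R);
  ex_cst : forall c, ex (fun=> c) = c;
  exD : forall f g, adm f -> adm g -> ex (fun w => f w + g w) = ex f + ex g;
  exZ : forall c f, adm f -> ex (fun w => c * f w) = c * ex f;
  ler_ex : forall f g, adm f -> adm g -> (forall w, f w <= g w) -> ex f <= ex g
}.
Arguments adm {R T}.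
Arguments ex {R T}.
Arguments adm_cst {R T}.
Arguments admD {R T}.
Arguments admM {R T}.
Arguments adm_pos {R T}.
Arguments ex_cst {R T}.
Arguments exD {R T}.
Arguments exZ {R T}.
Arguments ler_ex {R T}.

(** * Tails and even moments under an abstract expectation *)

Section Expectation.
Context {R : realType} {T : Type} (e : expectation_on R T).
Implicit Types (f g X : T -> R).

Lemma admZ c f : adm e f -> adm e (fun w => c * f w).
Proof. by move=> ef; apply: admM => //; exact: adm_cst. Qed.

Lemma admB f g : adm e f -> adm e g -> adm e (fun w => f w - g w).
Proof.
move=> ef eg; have := admD _ _ _ ef (admZ (-1) _ eg).
by congr adm; apply/funext => w; rewrite mulN1r.
Qed.

Lemma admX f k : adm e f -> adm e (fun w => f w ^+ k).
Proof.
move=> ef; elim: k => [|k IH].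
  by have := adm_cst e 1; congr adm; apply/funext => w; rewrite expr0.
by have := admM _ _ _ ef IH; congr adm; apply/funext => w; rewrite exprS.
Qed.

Lemma adm_sum {I : Type} (s : seq I) (F : I -> T -> R) :
  (forall i, adm e (F i)) -> adm e (fun w => \sum_(i <- s) F i w).
Proof.
move=> eF; elim: s => [|i s IH].
  by have := adm_cst e 0; congr adm; apply/funext => w; rewrite big_nil.
by have := admD _ _ _ (eF i) IH; congr adm; apply/funext => w; rewrite big_cons.
Qed.

Lemma exB f g : adm e f -> adm e g -> ex e (fun w => f w - g w) = ex e f - ex e g.
Proof.
move=> ef eg; rewrite -[- ex e g]mulN1r -exZ// -exD//; last exact: admZ.
by congr ex; apply/funext => w; rewrite mulN1r.
Qed.

Lemma ex_sum {I : Type} (s : seq I) (F : I -> T -> R) :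
  (forall i, adm e (F i)) ->
  ex e (fun w => \sum_(i <- s) F i w) = \sum_(i <- s) ex e (F i).
Proof.
move=> eF; elim: s => [|i s IH].
  by rewrite big_nil; apply: etrans (ex_cst e 0); congr ex; apply/funext => w; rewrite big_nil.
rewrite big_cons -IH -exD//; last exact: adm_sum.
by congr ex; apply/funext => w; rewrite big_cons.
Qed.

Lemma ex_ge0 f : adm e f -> (forall w, 0 <= f w) -> 0 <= ex e f.
Proof. by move=> ef f0; rewrite -(ex_cst e 0); apply: ler_ex => //; exact: adm_cst. Qed.

Definition tail X (z : R) := ex e (fun w => (z < `|X w|)%R%:R).

(** The structure offers indicators of [0 < f] only; for [0 <= z] the event reads
    [0 < X w ^+ 2 - z ^+ 2], which involves no absolute value. *)
Lemma adm_tail X (z : R) : 0 <= z -> adm e X -> adm e (fun w => (z < `|X w|)%R%:R).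
Proof.
move=> z0 eX; have := adm_pos _ _ (admB _ _ (admX _ 2 eX) (adm_cst e (z ^+ 2))).
congr adm; apply/funext => w; rewrite subr_gt0 -[X w ^+ 2]real_normK ?num_real//.
by rewrite ltr_pXn2r// nnegrE.
Qed.

Lemma tail_ge0 X (z : R) : 0 <= z -> adm e X -> 0 <= tail X z.
Proof. by move=> z0 eX; apply: ex_ge0 => [|w]; [exact: adm_tail|exact: ler0n]. Qed.

Lemma tail_le1 X (z : R) : 0 <= z -> adm e X -> tail X z <= 1.
Proof.
move=> z0 eX; rewrite -[leRHS](ex_cst e); apply: ler_ex => [||w].
- exact: adm_tail.
- exact: adm_cst.
- by case: (z < _); rewrite ?lexx ?ler01.
Qed.

Lemma markov_even X (z : R) k : 0 <= z -> adm e X ->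
  z ^+ k.*2 * tail X z <= ex e (fun w => X w ^+ k.*2).
Proof.
move=> z0 eX; rewrite /tail -exZ; last exact: adm_tail.
apply: ler_ex => [||w]; [by apply: admZ; exact: adm_tail|exact: admX|].
case: (ltP z `|X w|) => zX; last by rewrite mulr0 -mul2n exprM exprn_ge0// sqr_ge0.
rewrite mulr1 -[leRHS]ger0_norm ?normrX; last by rewrite -mul2n exprM exprn_ge0// sqr_ge0.
by rewrite lerXn2r// ?nnegrE// ltW.
Qed.

(** Instead of Cauchy-Schwarz, a pointwise bound is integrated: with y = X^2k, y <= y^2 / (4 B mu) +
    B mu 1_{|X| > z} + z^2k, where completing the square settles the case |X| > z. The outer terms
    contribute at most mu / 4 and mu / 2. *)
Lemma paley_zygmund_even X (z : R) k (B : R) : 0 <= z -> 0 < B -> adm e X ->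
  ex e (fun w => X w ^+ k.*2.*2) <= B * ex e (fun w => X w ^+ k.*2) ^+ 2 ->
  2 * z ^+ k.*2 < ex e (fun w => X w ^+ k.*2) ->
  1 <= 4 * B * tail X z.
Proof.
move=> z0 B0 eX; set mu := ex e (fun w => X w ^+ k.*2) => le4 ltz.
have zk0 : 0 <= z ^+ k.*2 by exact: exprn_ge0.
have mu0 : 0 < mu by lra.
have s0 : 0 < 2 * B * mu by rewrite !mulr_gt0.
have h1 : adm e (fun w => (4 * B * mu)^-1 * X w ^+ k.*2.*2) by apply: admZ; exact: admX.
have h2 : adm e (fun w => (B * mu) * (z < `|X w|)%R%:R) by apply: admZ; exact: adm_tail.
have h3 := admD _ _ _ h1 h2.
suff: mu <= ex e (fun w => (4 * B * mu)^-1 * X w ^+ k.*2.*2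
              + (B * mu) * (z < `|X w|)%R%:R + z ^+ k.*2).
  rewrite exD//; last exact: adm_cst.
  rewrite exD // (exZ e _ (fun w => X w ^+ _)); last exact: admX.
  rewrite (exZ _ _ (fun w => _%:R)); last exact: adm_tail.
  rewrite ex_cst -/(tail X z) => le1.
  have le2 : (4 * B * mu)^-1 * ex e (fun w => X w ^+ k.*2.*2) <= mu / 4.
    have := ler_wpM2l _ le4 => /(_ (4 * B * mu)^-1) le3.
    apply: (le_trans (le3 _)); first by rewrite invr_ge0 ltW// !mulr_gt0.
    rewrite le_eqVlt; apply/orP; left; apply/eqP; field.
    by rewrite !gt_eqF.
  have : mu * 1 <= mu * (4 * B * tail X z) by lra.
  by rewrite ler_pM2l.
apply: ler_ex => [||w]; [exact: admX|by apply: admD => //; exact: adm_cst|].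
have -> : X w ^+ k.*2.*2 = (X w ^+ k.*2) ^+ 2 by rewrite -exprM muln2.
have Xk : X w ^+ k.*2 = `|X w| ^+ k.*2.
  by rewrite -normrX ger0_norm// -mul2n exprM exprn_ge0// sqr_ge0.
set y := X w ^+ k.*2 in Xk *.
case: (ltP z `|X w|) => zX; rewrite ?mulr1 ?mulr0 ?addr0.
  suff : y <= (4 * B * mu)^-1 * y ^+ 2 + B * mu by lra.
  rewrite -subr_ge0.
  have -> : (4 * B * mu)^-1 * y ^+ 2 + B * mu - y =
     (4 * B * mu)^-1 * (y - 2 * B * mu) ^+ 2 by field; rewrite !gt_eqF.
  by rewrite mulr_ge0 ?sqr_ge0// invr_ge0 ltW// !mulr_gt0.
have : y <= z ^+ k.*2 by rewrite Xk lerXn2r ?nnegrE.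
suff : 0 <= (4 * B * mu)^-1 * y ^+ 2 by lra.
by rewrite mulr_ge0 ?sqr_ge0// invr_ge0 ltW// !mulr_gt0.
Qed.

End Expectation.
Arguments tail {R T}.

(* Take the smallest k = 2^n with 2 z^2k < E Y^2k. Paley-Zygmund at k bounds the tail of Y
   from below and Markov at k/2 bounds the tail of X from above. If there is no such k,
   Markov at all k = 2^n shows that the tail of X vanishes. *)
Lemma tail_le_of_moments (R : realType) (T1 T2 : Type)
    (e1 : expectation_on R T1) (e2 : expectation_on R T2)
    (X : T1 -> R) (Y : T2 -> R) (A B C : R) :
  1 <= A -> 1 <= B -> 8 * A * B ^+ 2 <= C -> adm e1 X -> adm e2 Y ->
  (forall k, (0 < k)%N ->
    ex e1 (fun w => X w ^+ k.*2) <= A ^+ k.*2 * ex e2 (fun w => Y w ^+ k.*2)) ->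
  (forall k, (0 < k)%N -> ex e2 (fun w => Y w ^+ k.*2.*2) <=
     B ^+ k.*2 * ex e2 (fun w => Y w ^+ k.*2) ^+ 2) ->
  forall z, 0 < z -> tail e1 X (C * z) <= C * tail e2 Y z.
Proof.
move=> A1 B1 CAB aX aY XY YY z z0.
have B2 : 1 <= B ^+ 2 by rewrite exprn_ege1.
have AB : 1 <= A * B ^+ 2 by rewrite mulr_ege1.
have C8 : 8 <= C by lra.
have C0 : 0 < C by lra.
have Cz0 : 0 <= C * z by rewrite mulr_ge0// ltW.
have A0 : 0 < A by lra.
have AC : 8 * A <= C.
  suff : A <= A * B ^+ 2 by lra.
  by rewrite ler_peMr//; lra.
pose good n := 2 * z ^+ (2 ^ n).*2 < ex e2 (fun w => Y w ^+ (2 ^ n).*2).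
have bad_tail n : ~~ good n ->
    tail e1 X (C * z) <= 2 * (A / C) ^+ (2 ^ n).*2.
  rewrite -leNgt => bad.
  have := markov_even e1 X (C * z) (2 ^ n) Cz0 aX.
  move=> /le_trans /(_ (XY _ _)); rewrite expn_gt0/= => /(_ isT).
  set h := (2 ^ n).*2 in bad *.
  move=> /le_trans /(_ (ler_wpM2l _ bad)).
  move=> /(_ (exprn_ge0 _ (ltW A0))); rewrite exprMn expr_div_n => le1.
  have zh : 0 < z ^+ h by exact: exprn_gt0.
  have ch : 0 < C ^+ h by exact: exprn_gt0.
  rewrite mulrA ler_pdivlMr// -(ler_pM2l zh); lra.
have PZ n : good n -> 1 <= 4 * B ^+ (2 ^ n).*2 * tail e2 Y z.
  move=> gn; apply: paley_zygmund_even => //; [exact: ltW|by rewrite exprn_gt0//; lra| |exact: gn].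
  by apply: YY; rewrite expn_gt0.
have t0 : 0 <= tail e2 Y z by apply: tail_ge0 => //; exact: ltW.
have [[n gn]|nog] := pselect (exists n, good n).
  have [n0 gn0 minn] := ex_minnP (ex_intro good n gn).
  case: n0 gn0 minn => [|n0] gn0 minn.
    (* At k = 1 there is no k / 2 for Markov; the trivial bound 1 suffices, since 4 B^2 <= C. *)
    apply: (le_trans (tail_le1 _ _ _ Cz0 aX)); have := PZ _ gn0.
    move=> /le_trans; apply; rewrite ler_wpM2r// expn0 -[1.*2]/2%N.
    suff : B ^+ 2 <= A * B ^+ 2 by lra.
    by rewrite ler_peMl//; lra.
  have bn0 : ~~ good n0 by apply/negP => /minn; rewrite ltnn.
  apply: (le_trans (bad_tail _ bn0)).
  have := PZ _ gn0; rewrite expnS mul2n.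
  (* Doubling the exponent squares the loss of Paley-Zygmund into (B^2)^h. It is cancelled against
     Markov by A B^2 <= C, and 8 <= C absorbs the numerical factors 2 and 4. *)
  set h := (2 ^ n0).*2 => le1.
  have Bh : 0 < (B ^+ 2) ^+ h by rewrite exprn_gt0//; lra.
  have le2 : (A / C) ^+ h * (B ^+ 2) ^+ h <= 1.
    rewrite -exprMn exprn_ile1//.
      by rewrite mulr_ge0 ?divr_ge0//; lra.
    by rewrite mulrAC ler_pdivrMr//; lra.
  have hE : B ^+ h.*2 = (B ^+ 2) ^+ h by rewrite -exprM mul2n.
  rewrite -(ler_pM2r Bh); rewrite hE in le1.
  apply: (@le_trans _ _ 2); first lra.
  have : 0 <= tail e2 Y z * (B ^+ 2) ^+ h by rewrite mulr_ge0// ltW.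
  move=> ?; nra.
suff le0 : tail e1 X (C * z) <= 0 by apply: (le_trans le0); rewrite mulr_ge0// ltW.
rewrite leNgt; apply/negP => tp.
have lt n : tail e1 X (C * z) <= 2 * (2^-1) ^+ n.
  have /bad_tail := introN idP (fun g => nog (ex_intro _ n g)).
  move=> /le_trans; apply; rewrite ler_pM2l//.
  apply: (@le_trans _ _ (2^-1 ^+ (2 ^ n).*2)).
    apply: lerXn2r; rewrite ?nnegrE ?divr_ge0//; try lra.
    by rewrite ler_pdivrMr//; lra.
  rewrite ler_wiXn2l//; try lra.
  by rewrite (leq_trans (ltnW (ltn_expl n (ltnSn 1))))// -addnn leq_addr.
pose N := (Num.truncn (2 / tail e1 X (C * z))).+1.
have := lt N; rewrite exprVn => le1.
have : 2 / tail e1 X (C * z) < N%:R by exact: truncnS_gt.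
rewrite ltr_pdivrMr// => lt2.
have N2 : N%:R <= 2 ^+ N :> R by rewrite -natrX ler_nat ltnW// ltn_expl.
have p2 : 0 < 2 ^+ N :> R by rewrite exprn_gt0.
move: le1; rewrite -ler_pdivrMr ?invr_gt0// invrK; nra.
Qed.
(** * Even powers and convexity *)
Section EvenPowers.
Context {R : realType}.
Implicit Types x y : R.

Lemma even_expr_ge0 x k : 0 <= x ^+ k.*2.
Proof. by rewrite -mul2n exprM exprn_ge0// sqr_ge0. Qed.

Lemma expr_tangent_le (p q : R) k : 0 <= p -> 0 <= q ->
  q ^+ k + k%:R * q ^+ k.-1 * (p - q) <= p ^+ k.
Proof.
move=> p0 q0; elim: k => [|[|k] IH]; first by rewrite !expr0 mul0r mul0r addr0.
  by rewrite !expr1 expr0 !mul1r addrC subrK.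
have := ler_wpM2l p0 IH; rewrite -exprS => /(le_trans _); apply.
rewrite /= !exprS -!natr1.
have h : 0 <= (k%:R + 1) * q ^+ k * (p - q) ^+ 2.
  by rewrite mulr_ge0 ?sqr_ge0// mulr_ge0 ?exprn_ge0// addr_ge0.
rewrite -subr_ge0; apply: le_trans h _.
by rewrite le_eqVlt; apply/orP; left; apply/eqP; ring.
Qed.

(** The tangent inequality for k-th powers at x^2 and y^2, then x^2 - y^2 >= 2 y (x - y). *)
Lemma even_expr_tangent_le k x y : (0 < k)%N ->
  y ^+ k.*2 + k.*2%:R * y ^+ (k.*2).-1 * (x - y) <= x ^+ k.*2.
Proof.
case: k => // k _; rewrite -mul2n !exprM.
apply: le_trans (expr_tangent_le _ _ _ (sqr_ge0 x) (sqr_ge0 y)).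
have -> : (2 * k.+1).-1 = (2 * k).+1 by rewrite mulnS.
rewrite (exprS y (2 * k)) exprM lerD2l /= natrM.
have h : 0 <= k.+1%:R * (y ^+ 2) ^+ k * (x - y) ^+ 2.
  by rewrite mulr_ge0 ?sqr_ge0// mulr_ge0// exprn_ge0// sqr_ge0.
rewrite -subr_ge0; apply: le_trans h _.
by rewrite le_eqVlt; apply/orP; left; apply/eqP; ring.
Qed.

(** Lets Jensen tolerate a total mass [v] below the normalisation [w]: the two sides differ by (2k -
    1) (w - v) y^2k. *)
Lemma even_expr_tangent_mass k (v w y : R) : (0 < k)%N -> v <= w ->
  w * y ^+ k.*2 <= v * y ^+ k.*2 + k.*2%:R * y ^+ (k.*2).-1 * (w * y - v * y).
Proof.
case: k => // k _ vw; rewrite doubleS /= exprS -!natr1.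
set z := y ^+ k.*2.+1.
have yz : 0 <= y * z by rewrite -exprS -doubleS even_expr_ge0.
have k0 : 0 <= k.*2%:R :> R by exact: ler0n.
rewrite -subr_ge0.
rewrite [leRHS](_ : _ = (k.*2%:R + 1) * ((w - v) * (y * z))); last ring.
by apply: mulr_ge0; [exact: addr_ge0|apply: mulr_ge0 => //; rewrite subr_ge0].
Qed.

Lemma jensen_even_sum {I : Type} (s : seq I) (lam x : I -> R) k :
  (0 < k)%N -> (forall i, 0 <= lam i) -> \sum_(i <- s) lam i <= 1 ->
  (\sum_(i <- s) lam i * x i) ^+ k.*2 <= \sum_(i <- s) lam i * x i ^+ k.*2.
Proof.
move=> k0 lam0 lam1; set y := \sum_(i <- s) lam i * x i.
have := even_expr_tangent_mass k _ _ y k0 lam1; rewrite !mul1r => /le_trans; apply.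
set L := k.*2%:R * _.
apply: (@le_trans _ _ (\sum_(i <- s) lam i * (y ^+ k.*2 + L * (x i - y)))); last first.
  by apply: ler_sum => i _; apply: ler_wpM2l => //; exact: even_expr_tangent_le.
rewrite le_eqVlt; apply/orP; left; apply/eqP.
rewrite [RHS](eq_bigr (fun i => lam i * (y ^+ k.*2 - L * y) + L * (lam i * x i))).
  by rewrite big_split/= -mulr_suml -mulr_sumr -/y; ring.
by move=> i _; ring.
Qed.

Lemma sum_double_of_odd0 (F : nat -> R) n : (forall j, F j.*2.+1 = 0) ->
  \sum_(i < n.*2.+1) F i = \sum_(j < n.+1) F j.*2.
Proof.
move=> F0; elim: n => [|n IH]; first by rewrite !big_ord_recl !big_ord0.
by rewrite doubleS 2!big_ord_recr [in RHS]big_ord_recr /= IH F0 addr0.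
Qed.

Lemma exprDB_even x y n :
  (x + y) ^+ n.*2 + (x - y) ^+ n.*2 =
  2 * \sum_(j < n.+1) 'C(n.*2, j.*2)%:R * (x ^+ (n - j).*2 * y ^+ j.*2).
Proof.
rewrite exprDn exprBn -big_split/=.
pose F i := 2 * (if odd i then 0 else 'C(n.*2, i)%:R * (x ^+ (n.*2 - i) * y ^+ i)).
rewrite (eq_bigr (fun i => F (val i))); last first.
  move=> i _; rewrite /F -signr_odd -[(_ * _) *+ _]mulr_natl -[((_ * _) * _) *+ _]mulr_natl.
  by case: (odd i); rewrite /= ?expr1 ?expr0; ring.
rewrite sum_double_of_odd0; last by move=> j; rewrite /F /= odd_double mulr0.
rewrite mulr_sumr; apply: eq_bigr => j _.
by rewrite /F odd_double -doubleB.
Qed.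

(** Odd powers cancel, and the even powers of [y] that remain have nonnegative coefficients. *)
Lemma ler_exprDB_even x y z n : `|y| <= `|z| ->
  (x + y) ^+ n.*2 + (x - y) ^+ n.*2 <= (x + z) ^+ n.*2 + (x - z) ^+ n.*2.
Proof.
move=> yz; rewrite !exprDB_even ler_pM2l//; apply: ler_sum => j _.
rewrite ler_wpM2l// ler_wpM2l ?even_expr_ge0//.
rewrite -[leLHS]ger0_norm ?even_expr_ge0// -[leRHS]ger0_norm ?even_expr_ge0//.
by rewrite !normrX lerXn2r ?nnegrE.
Qed.

(* Send j <= n to the pair (j, 0) and j > n to the pair (n, j - n). *)
Lemma submult_conv (al M : nat -> R) :
  (forall n, 0 <= al n) -> (forall n, 0 <= M n) -> M 0 = 1 -> al 0 = 1 ->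
  (forall n p, al (n + p)%N <= al n * al p) ->
  (forall n p, M (n + p)%N <= M n * M p) ->
  forall n p, \sum_(j < (n + p).+1) al j * M (n + p - j)%N <=
    (\sum_(j < n.+1) al j * M (n - j)%N) * (\sum_(j < p.+1) al j * M (p - j)%N).
Proof.
move=> al0 M0 M1 al1 alD MD n p.
rewrite -addSn big_split_ord /=.
rewrite [X in _ <= _ * X]big_ord_recl /= subn0 al1 mul1r mulrDr.
apply: lerD.
  rewrite mulr_suml; apply: ler_sum => j _; rewrite -mulrA ler_wpM2l//.
  by rewrite addnC -addnBA ?(ltnSE (ltn_ord j))// addnC MD.
apply: (@le_trans _ _ (al n * \sum_(i < p) al (bump 0 i) * M (p - bump 0 i)%N)).
  rewrite mulr_sumr; apply: ler_sum => j _.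
  have -> : (n + p - (n.+1 + j) = p - bump 0 j)%N.
    by rewrite /bump add1n addSnnS subnDl.
  rewrite mulrA ler_wpM2r// (le_trans _ (alD _ _))//.
  by rewrite /bump addSnnS add1n.
rewrite ler_wpM2r//; first by apply: sumr_ge0 => j _; rewrite mulr_ge0.
rewrite big_ord_recr /= subnn M1 mulr1 lerDr.
by apply: sumr_ge0 => j _; rewrite mulr_ge0.
Qed.

End EvenPowers.

Section WeightedJensen.
Context {R : realType} {T : Type} (e : expectation_on R T).

(** Jensen for the density [K], of mass at most [w]. The slack is for the Riesz product, whose mean
    over the signs is exactly 1 but over omega is only bounded. *)
Lemma jensen_even_weight (K X : T -> R) (w : R) k : (0 < k)%N -> 0 < w ->
  adm e K -> adm e X -> (forall t, 0 <= K t) -> ex e K <= w ->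
  w * (ex e (fun t => K t * X t) / w) ^+ k.*2 <= ex e (fun t => K t * X t ^+ k.*2).
Proof.
move=> k0 w0 aK aX K0 Kw; set y := _ / w.
apply: (le_trans (even_expr_tangent_mass k _ _ y k0 Kw)).
set L := k.*2%:R * _.
have aKX : adm e (fun t => K t * X t) by exact: admM.
have yE : ex e (fun t => K t * X t) = w * y by rewrite /y mulrC divfK// gt_eqF.
have h1 : adm e (fun t => y ^+ k.*2 * K t) by exact: admZ.
have h2 : adm e (fun t => y * K t) by exact: admZ.
have h3 : adm e (fun t => L * (K t * X t - y * K t)) by apply: admZ; exact: admB.
rewrite [leLHS](_ : _ = ex e (fun t => y ^+ k.*2 * K t + L * (K t * X t - y * K t))).
  apply: ler_ex => [||t].
  - exact: admD.
  - by apply: admM => //; exact: admX.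
  - have := ler_wpM2l (K0 t) (even_expr_tangent_le k (X t) y k0).
    by rewrite -/L; lra.
rewrite exD// (exZ e (y ^+ k.*2) K)// (exZ e L (fun t => K t * X t - y * K t)).
  by rewrite exB// (exZ e y K)// yE; ring.
exact: admB.
Qed.

End WeightedJensen.

(** * Random signs and Riesz products *)
Section Signs.
Context {R : realType}.

(* There is one sign more than needed, because [inord] requires a successor; indices above
   [m] all denote the coordinate 0. *)
Definition signs m := {ffun 'I_m.+1 -> bool}.

Definition sgn {m} (i : nat) (t : signs m) : R := (-1) ^+ t (inord i).

Definition flip {m} (i : nat) (t : signs m) : signs m :=
  [ffun l => t l (+) (l == inord i)].

Definition avg {m} (F : signs m -> R) : R := (\sum_t F t) / #|signs m|%:R.

Context {m : nat}.
Implicit Types (t : signs m) (F G : signs m -> R).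

Lemma flipK i : involutive (@flip m i).
Proof. by move=> t; apply/ffunP => l; rewrite !ffunE addbK. Qed.

Lemma sgn_flip i t : sgn i (flip i t) = - sgn i t.
Proof. by rewrite /sgn ffunE eqxx addbT signrN. Qed.

Lemma sgn_flip_neq i j t : (i <= m)%N -> (j <= m)%N -> i != j ->
  sgn j (flip i t) = sgn j t.
Proof.
move=> im jm ij; rewrite /sgn ffunE (_ : (_ == _) = false) ?addbF//.
by apply/negP => /eqP/(congr1 val)/=; rewrite !inordK// => /eqP; rewrite eq_sym (negbTE ij).
Qed.

Lemma sgn_sqr i t : sgn i t * sgn i t = 1.
Proof. by rewrite /sgn -expr2 sqrr_sign. Qed.

Lemma sgn_even i t k : sgn i t ^+ k.*2 = 1.
Proof. by rewrite -mul2n exprM expr2 sgn_sqr expr1n. Qed.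

Lemma sgnP i t : sgn i t = 1 \/ sgn i t = -1.
Proof. by rewrite /sgn; case: (t _); [right; rewrite expr1|left]. Qed.

Lemma normr_sgn i t : `|sgn i t| = 1.
Proof. by rewrite /sgn normr_sign. Qed.

Lemma card_signs_gt0 : 0 < #|signs m|%:R :> R.
Proof. by rewrite ltr0n card_ffun expn_gt0 card_bool. Qed.

Fact avg_cst (c : R) : avg (fun _ : signs m => c) = c.
Proof.
rewrite /avg (_ : \sum_t c = c * #|signs m|%:R) ?mulfK ?gt_eqF ?card_signs_gt0//.
by rewrite sumr_const mulr_natr.
Qed.

Fact avgD F G : avg (fun t => F t + G t) = avg F + avg G.
Proof. by rewrite /avg big_split mulrDl. Qed.

Fact avgZ c F : avg (fun t => c * F t) = c * avg F.
Proof. by rewrite /avg -mulr_sumr mulrA. Qed.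

Fact ler_avg F G : (forall t, F t <= G t) -> avg F <= avg G.
Proof.
by move=> FG; rewrite /avg ler_wpM2r ?invr_ge0 ?ler0n//; apply: ler_sum.
Qed.

Definition sign_expectation : expectation_on R (signs m) :=
  ExpectationOn R (signs m) (fun=> True) avg (fun=> I) (fun _ _ _ _ => I)
    (fun _ _ _ _ => I) (fun _ _ => I) avg_cst (fun F G _ _ => avgD F G)
    (fun c F _ => avgZ c F) (fun F G _ _ => ler_avg F G).

Lemma eq_avg F G : F =1 G -> avg F = avg G.
Proof. by move=> FG; congr avg; exact/funext. Qed.

Lemma avg_ge0 F : (forall t, 0 <= F t) -> 0 <= avg F.
Proof. by move=> F0; rewrite -(avg_cst 0); apply: ler_avg. Qed.

Lemma avg_sum {I : Type} (s : seq I) (F : I -> signs m -> R) :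
  avg (fun t => \sum_(i <- s) F i t) = \sum_(i <- s) avg (F i).
Proof. exact: (ex_sum sign_expectation). Qed.

Lemma avg_bij (h : signs m -> signs m) F : bijective h -> avg (F \o h) = avg F.
Proof.
by move=> bh; rewrite /avg; congr (_ / _); rewrite [RHS](reindex h)//; exact: onW_bij.
Qed.

Lemma avg_flip i F : avg F = 2^-1 * avg (fun t => F t + F (flip i t)).
Proof.
rewrite avgD -[X in _ * (_ + X)]/(avg (F \o flip i)) avg_bij; last first.
  by exists (flip i); exact: flipK.
by field.
Qed.

Lemma avg_mul_sgn0 i F : (forall t, F (flip i t) = F t) ->
  avg (fun t => F t * sgn i t) = 0.
Proof.
move=> Fi; rewrite (avg_flip i) -[RHS](avg_cst 0) -avgZ; apply: eq_avg => t.
by rewrite Fi sgn_flip; ring.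
Qed.

Lemma sum_flip (s : seq nat) (b : nat -> R) i t : (i <= m)%N ->
  {in s, forall j, (j <= m)%N && (j != i)} ->
  \sum_(j <- s) b j * sgn j (flip i t) = \sum_(j <- s) b j * sgn j t.
Proof.
move=> im sP; rewrite !big_seq; apply: eq_bigr => j /sP /andP[jm ji].
by rewrite sgn_flip_neq// eq_sym.
Qed.

Section Riesz.
Variable c : nat -> R.
Let K u t := \prod_(i < u) (1 + c i * sgn i t).

Let K_flip u i t : (u <= i)%N -> (i <= m)%N -> K u (flip i t) = K u t.
Proof.
move=> ui im; rewrite /K; apply: eq_bigr => j _.
by rewrite sgn_flip_neq//; have := ltn_ord j; lia.
Qed.

Lemma avg_riesz u : (u <= m.+1)%N -> avg (K u) = 1.
Proof.
elim: u => [|u IH] um.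
  by rewrite -[RHS]avg_cst; apply: eq_avg => t; rewrite /K big_ord0.
under eq_avg => t do rewrite /K big_ord_recr/= mulrDr mulr1 mulrCA.
rewrite avgD avgZ IH 1?ltnW// avg_mul_sgn0 ?mulr0 ?addr0// => t.
by rewrite -/(K u _) K_flip.
Qed.

(** Induction on the last factor: it supplies [c j] if its index is [j]; otherwise its sign averages
    out, as nothing else depends on it. *)
Lemma avg_riesz_sgn u j : (u <= m.+1)%N -> (j < u)%N ->
  avg (fun t => K u t * sgn j t) = c j.
Proof.
elim: u => // u IH um; rewrite ltnS leq_eqVlt => /predU1P[->|ju].
  under eq_avg => t do
    rewrite /K big_ord_recr/= mulrDr mulr1 mulrDl -mulrA -mulrA sgn_sqr mulr1 addrC mulrC.
  rewrite avgD avgZ avg_riesz 1?ltnW// avg_mul_sgn0 ?mulr1 ?addr0// => t.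
  by rewrite -/(K u _) K_flip.
rewrite (eq_avg _ (fun t => K u t * sgn j t + c u * (K u t * sgn j t * sgn u t))).
  2: by move=> t; rewrite /K big_ord_recr/=; ring.
rewrite avgD avgZ IH ?(ltnW um)// (avg_mul_sgn0 u (fun t => K u t * sgn j t)) ?mulr0 ?addr0// => t.
by rewrite K_flip// sgn_flip_neq//; lia.
Qed.

Lemma riesz_ge0 u t : (forall i, `|c i| <= 1) -> 0 <= K u t.
Proof.
move=> c1; apply: prodr_ge0 => i _; have := c1 i; rewrite ler_norml => /andP[? ?].
by case: (sgnP i t) => ->; lra.
Qed.

End Riesz.

(* The Riesz product is a probability weight under which [\sum a i * sgn i] has mean
   [\sum a i * c i]; apply Jensen. *)
Lemma sum_expr_le_avg_riesz (a c : nat -> R) k : (0 < k)%N ->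
  (forall i, `|c i| <= 1) ->
  (\sum_(i < m) a i * c i) ^+ k.*2 <=
  avg (fun t => \prod_(i < m) (1 + c i * sgn i t)
                * (\sum_(i < m) a i * sgn i t) ^+ k.*2).
Proof.
move=> k0 c1.
have := jensen_even_weight sign_expectation
  (fun t => \prod_(i < m) (1 + c i * sgn i t)) (fun t => \sum_(i < m) a i * sgn i t)
  1 k k0 ltr01 I I (fun t => riesz_ge0 c m t c1).
rewrite /= avg_riesz// lexx mul1r divr1 => /(_ isT); congr (_ ^+ _ <= _).
under eq_avg => t do rewrite mulr_sumr.
rewrite avg_sum; apply: eq_bigr => i _.
under eq_avg => t do rewrite mulrCA.
by rewrite avgZ avg_riesz_sgn.
Qed.

(** Averaging over sign [j] alone turns both sides into the symmetric sums of [ler_exprDB_even]. *)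
Lemma avg_contraction1 (X b d : signs m -> R) j k : (j <= m)%N ->
  (forall t, X (flip j t) = X t) -> (forall t, b (flip j t) = b t) ->
  (forall t, d (flip j t) = d t) -> (forall t, `|b t| <= `|d t|) ->
  avg (fun t => (X t + b t * sgn j t) ^+ k.*2) <=
  avg (fun t => (X t + d t * sgn j t) ^+ k.*2).
Proof.
move=> jm Xj bj dj bd; rewrite (avg_flip j) [leRHS](avg_flip j) ler_pM2l ?invr_gt0//.
apply: ler_avg => t; rewrite Xj bj dj sgn_flip !mulrN.
by apply: ler_exprDB_even; rewrite !normrM normr_sgn !mulr1.
Qed.

(* The coefficients [b] may depend on the signs of index below [i]. *)
Lemma avg_contraction (b : nat -> signs m -> R) (d : nat -> R) i k : (i <= m)%N ->
  (forall j l t, (i <= l)%N -> (l <= m)%N -> b j (flip l t) = b j t) ->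
  (forall j t, `|b j t| <= `|d j|) ->
  avg (fun t => (\sum_(i <= j < m) b j t * sgn j t) ^+ k.*2) <=
  avg (fun t => (\sum_(i <= j < m) d j * sgn j t) ^+ k.*2).
Proof.
move=> im bl bd.
(* Hybrid sum: the coefficients below [u] are already replaced by [d]. Raising [u] toggles only sign
   [u], which no coefficient sees. *)
pose H u t := \sum_(i <= j < u) d j * sgn j t + \sum_(u <= j < m) b j t * sgn j t.
suff HH u : (i <= u)%N -> (u <= m)%N ->
    avg (fun t => H i t ^+ k.*2) <= avg (fun t => H u t ^+ k.*2).
  have := HH m im (leqnn m); congr (_ <= _); apply: eq_avg => t.
    by rewrite /H big_geq// add0r.
  by rewrite /H [X in _ + X]big_geq// addr0.
elim: u => [|u IH]; first by rewrite leqn0 => /eqP -> _.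
rewrite leq_eqVlt => /predU1P[<- _ //|]; rewrite ltnS => iu um.
apply: (le_trans (IH iu (ltnW um))).
pose X t := \sum_(i <= j < u) d j * sgn j t + \sum_(u.+1 <= j < m) b j t * sgn j t.
have um' := ltnW um.
rewrite [leLHS](_ : _ = avg (fun t => (X t + b u t * sgn u t) ^+ k.*2)); last first.
  apply: eq_avg => t; congr (_ ^+ _); rewrite /H /X.
  by rewrite [X in _ + X = _]big_ltn//; ring.
rewrite [leRHS](_ : _ = avg (fun t => (X t + d u * sgn u t) ^+ k.*2)); last first.
  apply: eq_avg => t; congr (_ ^+ _); rewrite /H /X.
  by rewrite big_nat_recr//=; ring.
apply: avg_contraction1 => // t; last by exact: bl.
rewrite /X; congr (_ + _).
  by apply: sum_flip => // j; rewrite mem_index_iota; lia.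
have -> : \sum_(u.+1 <= j < m) b j (flip u t) * sgn j (flip u t) =
          \sum_(u.+1 <= j < m) b j t * sgn j (flip u t).
  by apply: eq_bigr => j _; rewrite bl.
by apply: (sum_flip _ (b ^~ t)) => // j; rewrite mem_index_iota; lia.
Qed.

End Signs.

(** * Moments of order 2k and 4k of sign sums *)

Section Hypercontractivity.
Context {R : realType} {m : nat}.
Variable a : nat -> R.

(** The coefficient of x^2n in the moment generating function of the partial sum, that is, in the
    product of the cosh (a_i x). Correspondingly [al u] lists the coefficients of cosh (a_u x), and
    [momS] is the Cauchy product. *)
Let mom u n := avg (fun t : signs m => (\sum_(i < u) a i * sgn i t) ^+ n.*2) / n.*2`!%:R.
Let al u n := a u ^+ n.*2 / n.*2`!%:R.

Let fact_neq0 n : n`!%:R != 0 :> R.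
Proof. by rewrite pnatr_eq0 -lt0n fact_gt0. Qed.

Let momS u n : (u < m.+1)%N -> mom u.+1 n = \sum_(j < n.+1) al u j * mom u (n - j)%N.
Proof.
move=> um; rewrite {1}/mom (avg_flip u).
rewrite (eq_avg _ (fun t => 2 * \sum_(j < n.+1) 'C(n.*2, j.*2)%:R * a u ^+ j.*2 *
    (\sum_(i < u) a i * sgn i t) ^+ (n - j).*2)); last first.
  move=> t; rewrite ![\sum_(i < u.+1) _]big_ord_recr /= sgn_flip mulrN.
  have -> : \sum_(i < u) a i * sgn i (flip u t) = \sum_(i < u) a i * sgn i t.
    by apply: eq_bigr => j _; rewrite sgn_flip_neq//; have := ltn_ord j; lia.
  rewrite exprDB_even; congr (2 * _). apply: eq_bigr => j _.
  by rewrite [(_ * sgn u t) ^+ _]exprMn sgn_even; ring.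
rewrite avgZ avg_sum mulrA mulVf// mul1r mulr_suml.
apply: eq_bigr => j _; rewrite avgZ.
have jn : (j <= n)%N by have := ltn_ord j; lia.
rewrite /mom /al.
have /(congr1 (fun n => n%:R : R)) : ('C(n.*2, j.*2) * (j.*2`! * (n - j).*2`!) = n.*2`!)%N.
  by rewrite doubleB bin_fact// leq_double.
rewrite !natrM => <-; field.
rewrite !fact_neq0 /= pnatr_eq0 -lt0n bin_gt0 leq_double; exact: jn.
Qed.

Let mom_ge0 u n : 0 <= mom u n.
Proof. by rewrite divr_ge0// avg_ge0// => t; exact: even_expr_ge0. Qed.

Let al_ge0 u n : 0 <= al u n.
Proof. by rewrite divr_ge0// even_expr_ge0. Qed.

Let mom0 u : mom u 0 = 1.
Proof. by rewrite /mom avg_cst divr1. Qed.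

Let al_submult u n p : al u (n + p)%N <= al u n * al u p.
Proof.
rewrite /al mulrACA -exprD -doubleD ler_wpM2l ?even_expr_ge0//.
rewrite -invfM lef_pV2 ?posrE ?mulr_gt0 ?ltr0n ?fact_gt0//.
rewrite -natrM ler_nat -(@bin_fact (n + p).*2 n.*2); last by rewrite leq_double leq_addr.
by rewrite -doubleB addKn leq_pmull// bin_gt0 leq_double leq_addr.
Qed.

Let mom_submult u n p : (u <= m.+1)%N -> mom u (n + p)%N <= mom u n * mom u p.
Proof.
elim: u n p => [|u IH] n p um.
  have z j : mom 0 j = (j == 0)%:R.
    case: j => [|j]; first exact: mom0.
    rewrite /mom; under eq_avg do rewrite big_ord0 expr0n/=.
    by rewrite avg_cst mul0r.
  by rewrite !z; case: n; case: p => *; rewrite ?mulr0 ?mul0r ?mulr1 ?addn0.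
rewrite !momS//; apply: (submult_conv (al u) (mom u)) => //.
- by rewrite /al expr0 divr1.
- by move=> *; apply: IH; exact: ltnW.
Qed.

(* The factor is a bound for 'C(4k, 2k): the moments divided by (2n)! are submultiplicative. *)
Lemma avg_hypercontractive k :
  avg (fun t : signs m => (\sum_(i < m) a i * sgn i t) ^+ k.*2.*2) <=
  4 ^+ k.*2 * avg (fun t : signs m => (\sum_(i < m) a i * sgn i t) ^+ k.*2) ^+ 2.
Proof.
have := mom_submult m k k (leqnSn m).
rewrite addnn /mom; set x := avg _; set y := avg _.
rewrite ler_pdivrMr ?ltr0n ?fact_gt0// => /le_trans; apply.
have y0 : 0 <= y by apply: avg_ge0 => t; exact: even_expr_ge0.
have /(congr1 (fun n => n%:R : R)) : ('C(k.*2.*2, k.*2) * (k.*2`! * k.*2`!) = k.*2.*2`!)%N.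
  rewrite -(@bin_fact k.*2.*2 k.*2); last by lia.
  by rewrite (_ : (k.*2.*2 - k.*2)%N = k.*2)//; lia.
rewrite !natrM => <-.
rewrite [leLHS](_ : _ = 'C(k.*2.*2, k.*2)%:R * y ^+ 2); last first.
  by field; rewrite !fact_neq0.
rewrite ler_wpM2r ?sqr_ge0//.
have -> : 4 ^+ k.*2 = (2 ^ k.*2.*2)%:R :> R.
  by rewrite natrX -[in RHS]mul2n exprM; congr (_ ^+ _); ring.
rewrite ler_nat; have -> : (2 = 1 + 1)%N by []. rewrite expnDn.
have kk : (k.*2 < k.*2.*2.+1)%N by rewrite ltnS -[leqRHS]addnn leq_addr.
by rewrite (bigD1 (Ordinal kk))//= !exp1n !muln1 leq_addr.
Qed.

End Hypercontractivity.

(** * The distribution of Rademacher sums *)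
Section Rademacher.
Context {R : realType}.
Implicit Types x c : R.

Lemma sin_natpi_gt0 (k : nat) (y : R) : k.*2%:R < y < k.*2.+1%:R -> 0 < sin (y * pi).
Proof.
rewrite -natr1 => /andP[y1 y2].
have := periodicn (@sinD2pi R) k ((y - k.*2%:R) * pi).
have -> : (y - k.*2%:R) * pi + pi *+ 2 *+ k = y * pi.
  by rewrite -mulrnA -[pi *+ _]mulr_natl mul2n -mulrDl subrK.
move=> ->; apply: sin_gt0_pi; apply/andP; split.
  by rewrite mulr_gt0 ?pi_gt0// subr_gt0.
by rewrite -[ltRHS]mul1r ltr_pM2r ?pi_gt0//; lra.
Qed.

Lemma rademacher_even (p k : nat) x :
  k.*2%:R < 2 ^+ p * x < k.*2.+1%:R -> rademacher p.+1 x = 1.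
Proof.
by move=> /sin_natpi_gt0 s0; rewrite /rademacher /= mulrAC gtr0_sg.
Qed.

Lemma rademacher_odd (p k : nat) x :
  k.*2.+1%:R < 2 ^+ p * x < k.*2.+2%:R -> rademacher p.+1 x = -1.
Proof.
rewrite -(@natr1 R k.*2) -(@natr1 R k.*2.+1) -(@natr1 R k.*2) => /andP[x1 x2].
rewrite /rademacher /= mulrAC.
rewrite -[2 ^+ p * x](subrK 1) mulrDl mul1r sinDpi ltr0_sg// oppr_lt0.
by apply: (sin_natpi_gt0 k); rewrite -natr1; apply/andP; split; lra.
Qed.

Definition dyadic_itv (n k : nat) : set R := [set x | k%:R < 2 ^+ n * x < k.+1%:R].

Lemma dyadic_itvE n k :
  dyadic_itv n k = `](k%:R / 2 ^+ n), (k.+1%:R / 2 ^+ n)[%classic.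
Proof.
apply/seteqP; split => x; rewrite /dyadic_itv /= in_itv/=.
  by rewrite ltr_pdivrMr ?exprn_gt0// ltr_pdivlMr ?exprn_gt0// mulrC.
by rewrite ltr_pdivrMr ?exprn_gt0// ltr_pdivlMr ?exprn_gt0// mulrC.
Qed.

Lemma measurable_dyadic_itv n k : measurable (dyadic_itv n k).
Proof. by rewrite dyadic_itvE; exact: measurable_itv. Qed.

Lemma measure_dyadic_itv n k :
  lebesgue_measure (dyadic_itv n k) = ((2 ^+ n)^-1)%:E.
Proof.
rewrite dyadic_itvE lebesgue_measure_itv /= lte_fin ltr_pM2r ?invr_gt0 ?exprn_gt0//.
by rewrite ltr_nat ltnSn -EFinD -mulrBl -natr1 addrAC subrr add0r mul1r.
Qed.

(** The intersection is empty or a singleton, whatever [S]. This disposes of the dyadic points,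
    where some of the sines vanish. *)
Lemma null_setI1 (S : set R) x :
  measurable (S `&` [set x]) /\ lebesgue_measure (S `&` [set x]) = 0%E.
Proof.
have [Sx|nSx] := pselect (S x).
  have -> : S `&` [set x] = [set x].
    by apply/seteqP; split => [y [] //|y ->]; split.
  by split; [exact: measurable_set1|exact: lebesgue_measure_set1].
have -> : S `&` [set x] = set0.
  by apply/seteqP; split => [y [Sy yx]|//]; apply: nSx; rewrite -yx.
by split; [exact: measurable0|exact: measure0].
Qed.

Context {m : nat}.
Variables (a : nat -> R) (z : R).

(** The offset [c] is the contribution of the signs of index below [p], already fixed; [S] is the
    counterpart on a dyadic interval. *)
Let G p c (t : signs m) : R := (z < `|c + \sum_(p <= i < m) a i * sgn i t|)%R%:R.

Let avg_G_step p c : (p < m)%N ->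
  avg (G p c) = 2^-1 * (avg (G p.+1 (c + a p)) + avg (G p.+1 (c - a p))).
Proof.
move=> pm; rewrite (avg_flip p) -avgD; congr (_ * _); apply: eq_avg => t.
have Gflip : \sum_(p.+1 <= i < m) a i * sgn i (flip p t) =
             \sum_(p.+1 <= i < m) a i * sgn i t.
  by apply: sum_flip => [|j]; rewrite ?mem_index_iota; lia.
rewrite /G !(big_ltn pm) Gflip sgn_flip !addrA.
by case: (@sgnP R _ p t) => ->; rewrite ?mulrN1 ?opprK ?mulr1// [LHS]addrC.
Qed.

Let S p n k c : set R := dyadic_itv n k `&`
  [set x | z < `|c + \sum_(p <= i < m) a i * rademacher i.+1 x|].

Lemma dyadic_split n k :
  dyadic_itv n k = (dyadic_itv n.+1 k.*2 `|` dyadic_itv n.+1 k.*2.+1)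
                   `|` [set k.*2.+1%:R / 2 ^+ n.+1].
Proof.
have e0 : 0 < 2 ^+ n :> R by rewrite exprn_gt0.
apply/seteqP; split => x; rewrite /dyadic_itv /= exprS -mulrA.
all: rewrite -(@natr1 R k) -(@natr1 R k.*2.+1) -(@natr1 R k.*2) -muln2 natrM.
  move=> /andP[x1 x2].
  case: (ltgtP (2 * (2 ^+ n * x)) (k%:R * 2 + 1)) => h.
  - by left; left; apply/andP; split; lra.
  - by left; right; apply/andP; split; lra.
  - right; rewrite -h; field; by rewrite gt_eqF.
move=> [[/andP[? ?]|/andP[? ?]]|->]; try by apply/andP; split; lra.
have -> : 2 ^+ n * ((k%:R * 2 + 1) / (2 * 2 ^+ n)) = k%:R + 2^-1 :> R.
  by field; rewrite gt_eqF.
by apply/andP; split; lra.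
Qed.

Let dyadic_disj n k : dyadic_itv n.+1 k.*2 `&` dyadic_itv n.+1 k.*2.+1 = set0.
Proof.
apply/seteqP; split => // x [] /= /andP[_ x1] /andP[x2 _].
by have := lt_trans x1 x2; rewrite ltxx.
Qed.

(** On the two halves of the interval [rademacher n.+2] is 1 and -1, so halving moves [a n.+1] into
    the offset with either sign, exactly as [avg_G_step] does; the midpoint is null. The induction
    is on the number of undetermined signs and yields measurability along the way. *)
Lemma measure_rademacher_tail_dyadic n k c :
  measurable (S n.+1 n k c) /\
  lebesgue_measure (S n.+1 n k c) = ((2 ^+ n)^-1 * avg (G n.+1 c))%:E.
Proof.
have [d] := ubnP (m - n); elim: d n k c => // d IH n k c.
rewrite ltnS => mn.
have [mp|pm] := leqP m n.+1.
  rewrite /G /S; under eq_avg do rewrite big_geq//.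
  rewrite avg_cst (_ : [set x | _] = [set _ | z < `|c + 0|]); last first.
    by apply/seteqP; split => x /=; rewrite big_geq.
  case: (z < _).
    rewrite mulr1 (_ : [set _ | _] = setT) ?setIT; last by apply/seteqP; split.
    by split; [exact: measurable_dyadic_itv|exact: measure_dyadic_itv].
  rewrite mulr0 (_ : [set _ | _] = set0) ?setI0; last by apply/seteqP; split.
  by split; [exact: measurable0|exact: measure0].
have [Ml El] := IH n.+1 k.*2 (c + a n.+1) ltac:(lia).
have [Mr Er] := IH n.+1 k.*2.+1 (c - a n.+1) ltac:(lia).
have SE : S n.+1 n k c =
  (S n.+2 n.+1 k.*2 (c + a n.+1) `|` S n.+2 n.+1 k.*2.+1 (c - a n.+1))
   `|` (S n.+1 n k c `&` [set k.*2.+1%:R / 2 ^+ n.+1]).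
  have lE : S n.+2 n.+1 k.*2 (c + a n.+1) = dyadic_itv n.+1 k.*2 `&`
     [set x | z < `|c + \sum_(n.+1 <= i < m) a i * rademacher i.+1 x|].
    apply/seteqP; split => x [Ix]; rewrite /S /= (big_ltn pm) (rademacher_even _ k)//.
      by rewrite mulr1 addrA; split.
    by rewrite mulr1 addrA; split.
  have rE : S n.+2 n.+1 k.*2.+1 (c - a n.+1) = dyadic_itv n.+1 k.*2.+1 `&`
     [set x | z < `|c + \sum_(n.+1 <= i < m) a i * rademacher i.+1 x|].
    apply/seteqP; split => x [Ix]; rewrite /S /= (big_ltn pm) (rademacher_odd _ k)//.
      by rewrite mulrN1 addrA; split.
    by rewrite mulrN1 addrA; split.
  rewrite lE rE -setIUl {1}/S {1}dyadic_split setIUl; congr (_ `|` _).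
  apply/seteqP; split => x /= [].
    move=> -> h; split => //; split => //.
    by rewrite dyadic_split; right.
  by move=> [_ h] xE; split.
have [M0 E0] := null_setI1 (S n.+1 n k c) (k.*2.+1%:R / 2 ^+ n.+1).
have Mlr := measurableU _ _ Ml Mr.
rewrite SE; split; first exact: measurableU.
rewrite measureU0// measureU//; last first.
  rewrite /S setIACA.
  by apply/seteqP; split => // x [h _]; rewrite -(dyadic_disj n k).
rewrite avg_G_step// [LHS](_ : _ = ((2 ^+ n.+1)^-1 * avg (G n.+2 (c + a n.+1)))%:E +
  ((2 ^+ n.+1)^-1 * avg (G n.+2 (c - a n.+1)))%:E)%E; last by rewrite -El -Er.
by rewrite -EFinD -mulrDr exprSr invfM -mulrA.
Qed.

End Rademacher.

Lemma avg_opp {R : realType} {m} (F : R -> R) (a : nat -> R) p :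
  avg (fun t : signs m => F (\sum_(p <= i < m) a i * sgn i t)) =
  avg (fun t : signs m => F (- \sum_(p <= i < m) a i * sgn i t)).
Proof.
pose neg (t : signs m) : signs m := [ffun l => ~~ t l].
have negK : involutive neg by move=> t; apply/ffunP => l; rewrite !ffunE negbK.
rewrite -[RHS](avg_bij neg); last by exists neg.
apply: eq_avg => t /=; congr F; rewrite -sumrN; apply: eq_bigr => i _.
by rewrite /sgn ffunE signrN mulrN opprK.
Qed.

(* [rademacher 1] is the constant 1 on ]0, 1[, not a random sign; the global symmetry of the
   other signs makes the tail of the absolute value the same. *)
Lemma rad_tailE {R : realType} m (a : nat -> R) (z : R) : 0 < z ->
  rad_tail m a z =
  (tail sign_expectation (fun t : signs m => \sum_(i < m) a i * sgn i t) z)%:E.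
Proof.
move=> z0; rewrite /rad_tail /tail /=.
case: m => [|m].
  rewrite (_ : [set x | _] = set0).
    rewrite measure0 (_ : avg _ = 0)// -[RHS](@avg_cst _ 0 0); apply: eq_avg => t.
    by rewrite big_ord0 normr0 ltNge ltW.
  by apply/seteqP; split => // x /= [_]; rewrite big_ord0 normr0 ltNge (ltW z0).
set A := [set x | _].
(* The interval is ]0, 1[, where the first Rademacher function is 1: the offset starts at [a 0]. *)
have [M E] := @measure_rademacher_tail_dyadic R m.+1 a z 0 0 (a 0).
have [M0 E0] := null_setI1 A 0.
have [M1 E1] := null_setI1 A 1.
set B := _ `&` _ in M E.
have -> : A = B `|` (A `&` [set 0]) `|` (A `&` [set 1]).
  have BA x : 0 < x < 1 -> B x <-> A x.
    move=> /andP[x0 x1]; rewrite /B /A /dyadic_itv /= expr0 mul1r x0 x1 !ltW//=.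
    rewrite -(big_mkord xpredT (fun i => a i * rademacher i.+1 x)).
    rewrite [\sum_(0 <= i < m.+1) _]big_ltn// (rademacher_even 0 0) ?expr0 ?mul1r ?x0//.
    by rewrite mulr1; split => [[_]|[_]].
  apply/seteqP; split => x.
    move=> Ax; have := Ax; rewrite {1}/A /= => -[/andP[x0 x1] _].
    move: x0; rewrite le_eqVlt => /predU1P[x0|x0]; first by left; right; split.
    move: x1; rewrite le_eqVlt => /predU1P[x1|x1]; first by right; split.
    by left; left; apply/BA => //; rewrite x0.
  move=> [[Bx|[]//]|[]//]; apply/BA => //.
  by move: Bx => [] /=; rewrite /dyadic_itv /= expr0 mul1r.
rewrite measureU0//; last exact: measurableU.
rewrite measureU0//; apply: etrans E _; congr _%:E.
rewrite expr0 invr1 mul1r.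
under [RHS]eq_avg => t do
  rewrite -(big_mkord xpredT (fun i => a i * sgn i t)) [\sum_(0 <= i < m.+1) _]big_ltn//.
rewrite [RHS](avg_flip 0) avgD.
set F := avg _.
have H (c : R) : avg (fun t : signs m.+1 =>
    (z < `|c + \sum_(1 <= i < m.+1) a i * sgn i t|)%R%:R) =
  avg (fun t : signs m.+1 =>
    (z < `|- c + \sum_(1 <= i < m.+1) a i * sgn i t|)%R%:R) :> R.
  rewrite (avg_opp (fun y => (z < `|c + y|)%R%:R)).
  by apply: eq_avg => t; rewrite -normrN opprD opprK.
rewrite -avgD (eq_avg _ (fun t : signs m.+1 =>
   (z < `|a 0 + \sum_(1 <= i < m.+1) a i * sgn i t|)%R%:R +
   (z < `|- a 0 + \sum_(1 <= i < m.+1) a i * sgn i t|)%R%:R)); last first.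
  move=> t; rewrite sgn_flip.
  rewrite sum_flip => [|//|j]; last by rewrite mem_index_iota; lia.
  by case: (@sgnP R _ 0 t) => ->; rewrite ?mulrN1 ?opprK ?mulr1// [LHS]addrC.
by rewrite avgD -H -/F; field.
Qed.

(** * Bounded random variables *)
Section ProbabilityExpectation.
Context {d : measure_display} {T : measurableType d} {R : realType}.
Variable P : probability T R.
Implicit Types f g : T -> R.

(** Boundedness closes the class under products, as [admM] demands. *)
Definition bounded_measurable f :=
  measurable_fun setT f /\ exists M, forall w, `|f w| <= M.

Let bm_integrable f : bounded_measurable f -> P.-integrable setT (EFin \o f).
Proof.
move=> [mf [M fM]]; apply: measurable_bounded_integrable => //.
  by apply: (@le_lt_trans _ _ 1%E); [exact: probability_le1|exact: ltry].
exists M; split; first exact: num_real.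
by move=> x Mx w _ /=; apply: (le_trans (fM w)); exact: ltW.
Qed.

Fact bm_cst (c : R) : bounded_measurable (fun=> c).
Proof. by split; [exact: measurable_cst|exists `|c|]. Qed.

Fact bmD f g : bounded_measurable f -> bounded_measurable g ->
  bounded_measurable (fun w => f w + g w).
Proof.
move=> [mf [M fM]] [mg [N gN]]; split; first exact: measurable_funD.
by exists (M + N) => w; rewrite (le_trans (ler_normD _ _))// lerD.
Qed.

Fact bmM f g : bounded_measurable f -> bounded_measurable g ->
  bounded_measurable (fun w => f w * g w).
Proof.
move=> [mf [M fM]] [mg [N gN]]; split; first exact: measurable_funM.
by exists (M * N) => w; rewrite normrM ler_pM.
Qed.

Let measurable_gt0 f : measurable_fun setT f -> measurable [set w | 0 < f w].
Proof.
move=> mf; rewrite [X in measurable X](_ : _ = f @^-1` `]0, +oo[).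
  by rewrite -[X in measurable X]setTI; exact: mf.
by apply/seteqP; split => w /=; rewrite in_itv/= andbT.
Qed.

Fact bm_pos f : bounded_measurable f -> bounded_measurable (fun w => (0 < f w)%R%:R).
Proof.
move=> [mf _]; split; last by exists 1 => w; rewrite normr_nat; case: (0 < f w); rewrite ?ler01.
rewrite (_ : (fun w => _) = \1_[set w | 0 < f w]); last first.
  apply/funext => w; rewrite indicE; congr (nat_of_bool _)%:R.
  by apply/idP/idP => [h|/set_mem//]; rewrite inE.
exact: measurable_indic (measurable_gt0 _ mf).
Qed.

Fact P_ex_cst (c : R) : \int[P]_w c = c.
Proof.
rewrite Rintegral_cst// -[RHS]mulr1; congr (_ * _).
by apply: (@EFin_inj R); rewrite fineK ?fin_num_measure//; exact: probability_setT.
Qed.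

Fact P_exD f g : bounded_measurable f -> bounded_measurable g ->
  \int[P]_w (f w + g w) = \int[P]_w f w + \int[P]_w g w.
Proof. by move=> bf bg; rewrite RintegralD//; exact: bm_integrable. Qed.

Fact P_exZ (c : R) f : bounded_measurable f ->
  \int[P]_w (c * f w) = c * \int[P]_w f w.
Proof. by move=> bf; rewrite RintegralZl//; exact: bm_integrable. Qed.

Fact P_ler_ex f g : bounded_measurable f -> bounded_measurable g ->
  (forall w, f w <= g w) -> \int[P]_w f w <= \int[P]_w g w.
Proof. by move=> bf bg fg; apply: le_Rintegral => //; exact: bm_integrable. Qed.

Definition P_expectation : expectation_on R T :=
  ExpectationOn R T bounded_measurable (fun f => \int[P]_w f w)
    bm_cst bmD bmM bm_pos P_ex_cst P_exD P_exZ P_ler_ex.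

Lemma P_tailE X z : 0 <= z -> bounded_measurable X ->
  P [set w | z < `|X w|] = (tail P_expectation X z)%:E.
Proof.
move=> z0 bX; set A := [set w | _].
have mA : measurable A.
  rewrite (_ : A = [set w | 0 < `|X w| - z]).
    apply: measurable_gt0; apply: measurable_funB => //.
    by apply: measurableT_comp => //; case: bX.
  by apply/seteqP; split => w; rewrite /A /= subr_gt0.
rewrite /tail /= /Rintegral (eq_integral (fun w => (\1_A w)%:E)); last first.
  move=> w _; rewrite indicE; congr (nat_of_bool _)%:R%:E.
  by apply/idP/idP => [h|/set_mem//]; rewrite inE.
by rewrite integral_indic// setIT fineK// fin_num_measure.
Qed.

End ProbabilityExpectation.

(** * Selection of an almost multiplicative subsequence *)
Definition unbounded (N : set nat) := forall n, exists2 j, (n <= j)%N & N j.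

Lemma unbounded_uniq_seq (N : set nat) K : unbounded N ->
  exists s : seq nat, [/\ uniq s, size s = K & {in s, forall i, N i}].
Proof.
move=> uN; elim: K => [|K [s [us sK sN]]]; first by exists [::].
have [j sj Nj] := uN (\max_(i <- s) i).+1.
exists (j :: s); split => /=; last by move=> i; rewrite inE => /predU1P[->|/sN].
  rewrite us andbT; apply/negP => js.
  by have := @leq_bigmax_seq _ s xpredT id j js isT; rewrite leqNgt sj.
by rewrite sK.
Qed.

(** If [i] does not serve unboundedly many j, it serves none beyond some [n0], and the rest of the
    list covers the members of [N] from there on. *)
Lemma unbounded_pigeonhole (I : eqType) (s : seq I) (N : set nat)
    (Q : I -> nat -> Prop) : unbounded N ->
  (forall j, N j -> exists2 i, i \in s & Q i j) ->
  exists2 i, i \in s & unbounded [set j | N j /\ Q i j].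
Proof.
elim: s N => [|i s IH] N uN NQ.
  by have [j _ /NQ[]] := uN 0.
have [ui|nui] := pselect (unbounded [set j | N j /\ Q i j]).
  by exists i => //; rewrite mem_head.
have [n0 Hn0] : exists n0, forall j, (n0 <= j)%N -> N j -> ~ Q i j.
  apply: contrapT => H; apply: nui => n; apply: contrapT => H'.
  by apply: H; exists n => j nj Nj Qj; apply: H'; exists j.
have [||i' i's ui'] := IH [set j | N j /\ (n0 <= j)%N].
- move=> n; have [j nj Nj] := uN (maxn n n0).
  by move: nj; rewrite geq_max => /andP[nj n0j]; exists j.
- move=> j [Nj n0j]; have [i' i's Qi'] := NQ j Nj.
  move: i's; rewrite inE => /predU1P[i'i|i's]; last by exists i'.
  by have := Hn0 j n0j Nj; rewrite -i'i.
exists i'; first by rewrite inE i's orbT.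
by move=> n; have [j nj [[Nj _] Qj]] := ui' n; exists j.
Qed.

Definition riesz {R : realType} {T : Type} (D : R) (phi : nat -> T -> R) (s : nat -> R)
  (n : nat) (w : T) : R := \prod_(i < n) (1 + phi i w / D * s i).

Section Selection.
Context {R : realType} {T : Type} (e : expectation_on R T).
Variables (f : nat -> T -> R) (D : R).
Hypothesis adm_f : forall n, adm e (f n).
Hypothesis f_orth : forall n m, ex e (fun w => f n w * f m w) = (n == m)%:R.
Hypothesis D1 : 1 <= D.
Hypothesis f_le : forall n w, `|f n w| <= D.

(** Subtracting the projection [c * f i] keeps the coefficients at the other indices and lowers the
    second moment by c^2. *)
Lemma bessel (s : seq nat) g : uniq s -> adm e g ->
  \sum_(i <- s) ex e (fun w => f i w * g w) ^+ 2 <= ex e (fun w => g w ^+ 2).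
Proof.
elim: s g => [|i s IH] g.
  by move=> _ ag; rewrite big_nil ex_ge0// => [|w]; [exact: admX|exact: sqr_ge0].
rewrite cons_uniq => /andP[si us] ag; rewrite big_cons.
set c := ex e (fun w => f i w * g w).
have acf : adm e (fun w => c * f i w) by exact: admZ.
have aff j : adm e (fun w => f j w * f i w) by exact: admM.
have afg j : adm e (fun w => f j w * g w) by exact: admM.
have ag' : adm e (fun w => g w - c * f i w) by exact: admB.
have := IH _ us ag'.
rewrite (eq_big_seq (fun j => ex e (fun w => f j w * g w) ^+ 2)); last first.
  move=> j js; congr (_ ^+ 2).
  rewrite (_ : (fun w => _) = fun w => f j w * g w - c * (f j w * f i w)); last first.
    by apply/funext => w; ring.
  rewrite exB//; last exact: admZ.
  rewrite (exZ e c (fun w => f j w * f i w))// f_orth.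
  by rewrite (negbTE (memPn si _ js)) mulr0 subr0.
rewrite -(lerD2l (c ^+ 2)) => /le_trans; apply.
rewrite (_ : (fun w => (g w - c * f i w) ^+ 2) =
  fun w => (g w ^+ 2 - (2 * c) * (f i w * g w)) + c ^+ 2 * (f i w * f i w)).
  rewrite exD; [|by apply: admB; [exact: admX|exact: admZ]|exact: admZ].
  rewrite exB; [|exact: admX|exact: admZ].
  rewrite (exZ e _ (fun w => f i w * g w))// (exZ e _ (fun w => f i w * f i w))//.
  by rewrite f_orth eqxx (_ : true%:R = 1 :> R)// -/c le_eqVlt; apply/orP; left; apply/eqP; ring.
by apply/funext => w; ring.
Qed.

(** Counting: if each index of [s] failed some test, Bessel summed over [H] would be violated. *)
Lemma bessel_select (s : seq nat) (H : seq (T -> R)) (delta : R) :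
  uniq s -> {in H, forall h, adm e h} -> 0 <= delta ->
  \sum_(h <- H) ex e (fun w => h w ^+ 2) < delta ^+ 2 * (size s)%:R ->
  exists2 i, i \in s & {in H, forall h, `|ex e (fun w => f i w * h w)| <= delta}.
Proof.
move=> us aH d0; rewrite ltNge => /negP lt; apply: contrapT => nex; apply: lt.
apply: (@le_trans _ _ (\sum_(i <- s) \sum_(h <- H) ex e (fun w => f i w * h w) ^+ 2)).
  have -> : delta ^+ 2 * (size s)%:R = \sum_(i <- s) delta ^+ 2.
    by rewrite big_const_seq count_predT iter_addr_0 mulr_natr.
  rewrite big_seq [leRHS]big_seq; apply: ler_sum => i si; rewrite leNgt; apply/negP => lt.
  apply: nex; exists i => // h hH.
  rewrite -(@ler_pXn2r _ 2)// ?nnegrE// -normrX ger0_norm ?sqr_ge0//.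
  apply: (le_trans _ (ltW lt)); rewrite (big_rem h hH)/= lerDl.
  by apply: sumr_ge0 => h' _; exact: sqr_ge0.
rewrite exchange_big/= big_seq [leRHS]big_seq; apply: ler_sum => h hH.
by apply: bessel => //; exact: aH.
Qed.

(** The signs are unknown when an index is picked, so both are kept; the last two factors serve to
    build the tests phi_j Q_n. *)
Let factors (phi : T -> R) : seq (T -> R) :=
  [:: (fun w => 1 + phi w / D * 1); (fun w => 1 + phi w / D * -1);
      (fun w => phi w * (1 + phi w / D * 1)); (fun w => phi w * (1 + phi w / D * -1))].

Let next (G : seq (T -> R)) (phi : T -> R) : seq (T -> R) :=
  [seq (fun w => g w * h w) | g <- G, h <- factors phi].

Let all_adm (G : seq (T -> R)) := {in G, forall g, adm e g}.

Let adm_next G n : all_adm G -> all_adm (next G (f n)).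
Proof.
move=> aG h /allpairsP[[g h'] /= [gG h'f ->]]; apply: admM; first exact: aG.
have a1 c : adm e (fun w => 1 + f n w / D * c).
  apply: admD; first exact: adm_cst.
  by apply: admM; [apply: admM => //|]; exact: adm_cst.
move: h'f; rewrite !inE => /or4P[] /eqP -> //; exact: admM.
Qed.

(* By Bessel, for each j some member of a fixed finite set of candidates i passes all the
   tests against [g] and [f j ^ 2 * g]; by pigeonhole one candidate serves infinitely many j. *)
Lemma selection_step (G : seq (T -> R)) (N : set nat) (delta : R) :
  all_adm G -> unbounded N -> 0 < delta ->
  exists i N', [/\ N i, unbounded N', N' `<=` N, (forall j, N' j -> (i < j)%N) &
    {in G, forall g, `|ex e (fun w => f i w * g w)| <= delta} /\
    (forall j, N' j -> {in G, forall g,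
       `|ex e (fun w => f i w * (f j w ^+ 2 * g w))| <= delta})].
Proof.
move=> aG uN d0.
pose H j := G ++ [seq (fun w => f j w ^+ 2 * g w) | g <- G].
have aH j : all_adm (H j).
  move=> h; rewrite mem_cat => /orP[|/mapP[g gG ->]]; first exact: aG.
  by apply: admM; [exact: admX|exact: aG].
(* A bound uniform in [j], from |f_j| <= D: one set of [K] candidates must work for all [j] before
   the pigeonhole applies. *)
pose M := \sum_(g <- G) ex e (fun w => g w ^+ 2) +
          \sum_(g <- G) D ^+ 4 * ex e (fun w => g w ^+ 2).
have HM j : \sum_(h <- H j) ex e (fun w => h w ^+ 2) <= M.
  rewrite big_cat/= lerD2l big_map big_seq [leRHS]big_seq; apply: ler_sum => g gG.
  have ag := aG _ gG.
  rewrite -(exZ e _ (fun w => g w ^+ 2)); last exact: admX.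
  apply: ler_ex => [||w].
  - by apply: admX; apply: admM => //; exact: admX.
  - by apply: admZ; exact: admX.
  rewrite exprMn ler_wpM2r ?sqr_ge0// -exprM -[leLHS]ger0_norm ?exprn_even_ge0//.
  by rewrite normrX; apply: lerXn2r; rewrite ?nnegrE//; have := D1; lra.
pose K := (Num.truncn (M / delta ^+ 2)).+1.
have [s [us sK sN]] := unbounded_uniq_seq N K uN.
have d20 : 0 < delta ^+ 2 by rewrite exprn_gt0.
have [] := unbounded_pigeonhole _ s N
   (fun i j => {in H j, forall h, `|ex e (fun w => f i w * h w)| <= delta}) uN.
  move=> j _; apply: bessel_select => //; [exact: aH|exact: ltW|].
  apply: (le_lt_trans (HM j)); rewrite sK mulrC -ltr_pdivrMr//; exact: truncnS_gt.
move=> i si ui; exists i, [set j | (N j /\ {in H j, forall h,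
   `|ex e (fun w => f i w * h w)| <= delta}) /\ (i < j)%N].
split; [exact: sN| | |by move=> j []|split].
- move=> n; have [j nj Hj] := ui (maxn n i.+1).
  by move: nj; rewrite geq_max => /andP[nj ij]; exists j.
- by move=> j [[]].
- move=> g gG; have [j _ [_]] := ui 0; apply.
  by rewrite mem_cat gG.
- move=> j [[_ Hj] _] g gG.
  apply: Hj; rewrite mem_cat; apply/orP; right.
  exact: (map_f (fun g w => f j w ^+ 2 * g w)).
Qed.

Variable eps : nat -> R.
Hypothesis eps_gt0 : forall n, 0 < eps n.

(** A state of the dependent choice. Indices in [pool] have passed, with their squares, the tests of
    all picks made so far; [picked] is the pick leading to this stage, a dummy at stage 0. *)
Record stage := Stage {
  rank : nat; tests : seq (T -> R); pool : set nat; picked : nat;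
  tests_adm : all_adm tests; pool_unbounded : unbounded pool }.

Let succ_stage (x y : stage) := [/\ rank y = (rank x).+1, pool x (picked y),
  pool y `<=` pool x, (forall j, pool y j -> (picked y < j)%N) &
  [/\ tests y = next (tests x) (f (picked y)),
      {in tests x, forall g, `|ex e (fun w => f (picked y) w * g w)| <= eps (rank x)} &
      forall j, pool y j -> {in tests x, forall g,
       `|ex e (fun w => f (picked y) w * (f j w ^+ 2 * g w))| <= eps (rank x)}]].

Let succ_stage_ex (x : stage) : exists y, succ_stage x y.
Proof.
have [i [N' [Ni uN' N'N iN' [h1 h2]]]] :=
  selection_step (tests x) (pool x) (eps (rank x)) (tests_adm x) (pool_unbounded x)
    (eps_gt0 _).
by exists (Stage (rank x).+1 (next (tests x) (f i)) N' i
  (adm_next _ i (tests_adm x)) uN').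
Qed.

(** The choice of [sigma] precedes [s] because the tests at stage n contain Q_n and all phi_j Q_n
    for every sign pattern. The last bound holds since [sigma j], n < j, is drawn from the pool left
    after pick n. *)
Lemma almost_multiplicative_subsequence : exists sigma : nat -> nat,
  (forall i, (sigma i < sigma i.+1)%N) /\
  forall s, (forall i, s i = 1 \/ s i = -1) ->
  let phi i := f (sigma i) in let Q := riesz D phi s in
  [/\ forall n, `|ex e (fun w => phi n w * Q n w)| <= eps n,
      forall j n, (j < n)%N ->
        `|ex e (fun w => phi n w * (phi j w * Q n w))| <= eps n &
      forall j n, (n < j)%N ->
        `|ex e (fun w => phi n w * (phi j w ^+ 2 * Q n w))| <= eps n].
Proof.
have a0 : all_adm [:: fun=> 1].
  by move=> g; rewrite inE => /eqP ->; exact: adm_cst.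
have uT : unbounded setT by move=> n; exists n.
have [F [F0 FS]] := dependent_choice (fun x => cid (succ_stage_ex x))
  (Stage 0 [:: fun=> 1] setT 0 a0 uT).
have Frank n : rank (F n) = n.
  by elim: n => [|n IH]; [rewrite F0|have [-> _ _ _ _] := FS n; rewrite IH].
pose sigma n := picked (F n.+1).
have Fpool n m : (n <= m)%N -> pool (F m) `<=` pool (F n).
  elim: m => [|m IH]; first by rewrite leqn0 => /eqP ->.
  rewrite leq_eqVlt => /predU1P[->//|nm] j; have [_ _ h _ _] := FS m.
  by move=> /h; exact: IH.
have sigma_pool n : pool (F n) (sigma n) by have [] := FS n.
have sigma_later n j : (n < j)%N -> pool (F n.+1) (sigma j).
  by move=> nj; apply: (Fpool _ _ nj); exact: sigma_pool.
exists sigma; split.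
  by move=> i; have [_ _ _ + _] := FS i; apply; exact: sigma_pool.
move=> s s1 phi Q.
have Qin n : Q n \in tests (F n) /\
    forall j, (j < n)%N -> (fun w => phi j w * Q n w) \in tests (F n).
  elim: n => [|n [IH1 IH2]].
    split => //; rewrite F0 inE; apply/eqP/funext => w.
    by rewrite /Q /riesz big_ord0.
  have [_ _ _ _ [-> _ _]] := FS n; rewrite -/(sigma n) -/(phi n).
  have hin : (fun w => 1 + phi n w / D * s n) \in factors (phi n).
    by case: (s1 n) => ->; rewrite !inE eqxx ?orbT.
  have hin' : (fun w => phi n w * (1 + phi n w / D * s n)) \in factors (phi n).
    by case: (s1 n) => ->; rewrite !inE eqxx ?orbT.
  have QS : Q n.+1 = fun w => Q n w * (1 + phi n w / D * s n).
    by apply/funext => w; rewrite /Q /riesz big_ord_recr.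
  split; first by rewrite QS; exact: (allpairs_f (fun g h w => g w * h w)).
  move=> j; rewrite ltnS leq_eqVlt => /predU1P[->|jn].
    rewrite (_ : (fun w => _) = fun w => Q n w * (phi n w * (1 + phi n w / D * s n))).
      exact: (allpairs_f (fun g h w => g w * h w)).
    by apply/funext => w; rewrite QS mulrCA.
  rewrite (_ : (fun w => _) = fun w => phi j w * Q n w * (1 + phi n w / D * s n)).
    by apply: (allpairs_f (fun g h w => g w * h w)) => //; exact: IH2.
  by apply/funext => w; rewrite QS mulrA.
split => [n|j n jn|j n nj].
- by have [_ _ _ _ [_ + _]] := FS n; rewrite Frank; apply; have [] := Qin n.
- by have [_ _ _ _ [_ + _]] := FS n; rewrite Frank; apply; apply: (Qin n).2.
- have [_ _ _ _ [_ _]] := FS n; rewrite Frank => /(_ _ (sigma_later _ _ nj)); apply.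
  by have [] := Qin n.
Qed.

End Selection.

(** * Comparison of moments *)
(** A second contraction raises the coefficients below [i] from 0 to [d]. *)
Lemma avg_contraction_full {R : realType} {m} (b : nat -> signs m -> R) (d : nat -> R) i k :
  (i <= m)%N ->
  (forall j l t, (i <= l)%N -> (l <= m)%N -> b j (flip l t) = b j t) ->
  (forall j t, `|b j t| <= `|d j|) ->
  avg (fun t => (\sum_(i <= j < m) b j t * sgn j t) ^+ k.*2) <=
  avg (fun t : signs m => (\sum_(j < m) d j * sgn j t) ^+ k.*2).
Proof.
move=> im bl bd; apply: (le_trans (avg_contraction b d i k im bl bd)).
pose d' j := if (i <= j)%N then d j else 0.
have h := @avg_contraction R m (fun j _ => d' j) d 0 k (leq0n m) _ _.
have {}h : avg (fun t : signs m => (\sum_(0 <= j < m) d' j * sgn j t) ^+ k.*2) <=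
           avg (fun t : signs m => (\sum_(0 <= j < m) d j * sgn j t) ^+ k.*2).
  by apply: h => // j t; rewrite /d'; case: ifP; rewrite ?normr0.
apply: (le_trans _ (le_trans h _)); apply: ler_avg => t; last by rewrite big_mkord.
rewrite (big_cat_nat (leq0n i) im)//= [X in X + _]big1_seq ?add0r.
  rewrite le_eqVlt; apply/orP; left; apply/eqP; congr (_ ^+ _).
  by apply: eq_big_nat => j /andP[ij _]; rewrite /d' ij.
by move=> j; rewrite mem_index_iota /= => ji; rewrite /d' leqNgt ji mul0r.
Qed.

Lemma geometric4_le {R : realType} l u :
  \sum_(l <= i < u) (4 ^+ i)^-1 <= 4 / 3 * (4 ^+ l)^-1 :> R.
Proof.
have [lu|ul] := leqP l u; last first.
  by rewrite big_geq ?(ltnW ul)// mulr_ge0// ?invr_ge0 ?exprn_ge0//; lra.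
suff : \sum_(l <= i < u) (4 ^+ i)^-1 <= 4 / 3 * ((4 ^+ l)^-1 - (4 ^+ u)^-1) :> R.
  have : 0 < (4 ^+ u)^-1 :> R by rewrite invr_gt0 exprn_gt0.
  by move=> ? ?; lra.
elim: u lu => [|u IH]; first by rewrite leqn0 => /eqP ->; rewrite big_geq// subrr mulr0.
rewrite leq_eqVlt => /predU1P[->|]; first by rewrite big_geq// subrr mulr0.
rewrite ltnS => lu; rewrite big_nat_recr//=; have := IH lu.
by rewrite [4 ^+ u.+1]exprS invfM; lra.
Qed.

Lemma sum_halves_le1 {R : realType} u : \sum_(n < u) (2 ^+ n.+1)^-1 <= 1 :> R.
Proof.
suff : \sum_(n < u) (2 ^+ n.+1)^-1 = 1 - (2 ^+ u)^-1 :> R.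
  have : 0 < (2 ^+ u)^-1 :> R by rewrite invr_gt0 exprn_gt0.
  by move=> ? ->; lra.
elim: u => [|u IH]; first by rewrite big_ord0 expr0 invr1 subrr.
by rewrite big_ord_recr/= IH exprS invfM; lra.
Qed.

Lemma sum_triangle {V : nmodType} (F : nat -> nat -> V) m :
  \sum_(i < m) \sum_(i.+1 <= j < m) F i j = \sum_(j < m) \sum_(0 <= i < j) F i j.
Proof.
elim: m => [|m IH]; first by rewrite !big_ord0.
rewrite big_ord_recr [RHS]big_ord_recr /= -IH big_geq// addr0 big_mkord -big_split/=.
by apply: eq_bigr => i _; rewrite big_nat_recr.
Qed.

Section Moments.
Context {R : realType} {T : Type} (e : expectation_on R T).
Variables (phi : nat -> T -> R) (D : R).
Hypothesis adm_phi : forall n, adm e (phi n).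
Hypothesis phi_sqr : forall n, ex e (fun w => phi n w ^+ 2) = 1.
Hypothesis D1 : 1 <= D.
Hypothesis phi_le : forall n w, `|phi n w| <= D.
(** Chosen so that D times the sum of eps_i over i >= l is at most 4^-l / 6, and 2^(i+3) eps_i =
    2^-i / D: an error of weight 2^-(i+3) stays a contraction after division by its weight. *)
Let eps n : R := (4 ^+ n)^-1 / (8 * D).
Hypothesis phi_Q : forall s, (forall i, s i = 1 \/ s i = -1) ->
  let Q := riesz D phi s in
  [/\ forall n, `|ex e (fun w => phi n w * Q n w)| <= eps n,
      forall j n, (j < n)%N ->
        `|ex e (fun w => phi n w * (phi j w * Q n w))| <= eps n &
      forall j n, (n < j)%N ->
        `|ex e (fun w => phi n w * (phi j w ^+ 2 * Q n w))| <= eps n].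

Let D0 : 0 < D. Proof. exact: lt_le_trans D1. Qed.

Let sum_eps l u : D * \sum_(l <= i < u) eps i <= (4 ^+ l)^-1 / 6.
Proof.
rewrite -mulr_suml mulrC -mulrA [X in _ * X](_ : _ = 8^-1); last first.
  by field; rewrite gt_eqF.
by have := @geometric4_le R l u; lra.
Qed.

Context {m : nat}.
Implicit Types (t : signs m).
Let s t i : R := sgn i t.
Let Q t n := riesz D phi (s t) n.

Let sP t i : s t i = 1 \/ s t i = -1. Proof. exact: sgnP. Qed.

Let s_norm t i : `|s t i| = 1. Proof. exact: normr_sgn. Qed.

Let adm_Q t n : adm e (Q t n).
Proof.
elim: n => [|n IH].
  by have := adm_cst e 1; congr adm; apply/funext => w; rewrite /Q /riesz big_ord0.
have -> : Q t n.+1 = fun w => Q t n w * (1 + phi n w / D * s t n).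
  by apply/funext => w; rewrite /Q /riesz big_ord_recr.
apply: admM => //; apply: admD; first exact: adm_cst.
by apply: admM; [apply: admM => //|]; exact: adm_cst.
Qed.

Let c_le1 w i : `|phi i w / D| <= 1.
Proof. by rewrite normrM normfV [`|D|]gtr0_norm// ler_pdivrMr// mul1r. Qed.

Let Q_ge0 t n w : 0 <= Q t n w.
Proof. exact: (riesz_ge0 (fun i => phi i w / D)). Qed.

(** Consecutive products differ by Q_{i+1} - Q_i = (s_i / D) phi_i Q_i, so for suitable [g] every
    increment is an expectation bounded by [phi_Q]. *)
Let ex_Q_telescope t (g : T -> R) l u : adm e g -> (l <= u)%N ->
  ex e (fun w => g w * Q t u w) = ex e (fun w => g w * Q t l w) +
    \sum_(l <= i < u) s t i / D * ex e (fun w => phi i w * (g w * Q t i w)).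
Proof.
move=> ag; elim: u => [|u IH]; first by rewrite leqn0 => /eqP ->; rewrite big_geq ?addr0.
rewrite leq_eqVlt => /predU1P[->|]; first by rewrite big_geq ?addr0.
rewrite ltnS => lu; rewrite big_nat_recr//= addrA -IH//.
have agQ : adm e (fun w => g w * Q t u w) by exact: admM.
have apgQ : adm e (fun w => phi u w * (g w * Q t u w)) by exact: admM.
rewrite -exZ// -exD//; last exact: admZ.
congr ex; apply/funext => w; rewrite /Q /riesz big_ord_recr/=; ring.
Qed.

Let ex_Q_le2 t : ex e (Q t m) <= 2.
Proof.
have := ex_Q_telescope t (fun=> 1) 0 m (adm_cst e 1) (leq0n m).
have -> : (fun w => 1 * Q t m w) = Q t m by apply/funext => w; rewrite mul1r.
have -> : (fun w => 1 * Q t 0 w) = fun=> 1.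
  by apply/funext => w; rewrite /Q /riesz big_ord0 mulr1.
move=> ->; rewrite ex_cst -[leRHS]/(1 + 1) lerD2l.
have le1 : \sum_(0 <= i < m) s t i / D * ex e (fun w => phi i w * (1 * Q t i w)) <=
    D * \sum_(0 <= i < m) eps i.
  rewrite mulr_sumr; apply: ler_sum => i _.
  have -> : (fun w => phi i w * (1 * Q t i w)) = (fun w => phi i w * Q t i w).
    by apply/funext => w; rewrite mul1r.
  apply: (le_trans (ler_norm _)); rewrite normrM normrM s_norm mul1r.
  have [+ _ _] := phi_Q (s t) (sP t) => /(_ i) h.
  apply: ler_pM => //; rewrite normfV gtr0_norm//.
  by apply: (@le_trans _ _ 1) => //; rewrite invf_le1.
apply: (le_trans le1); apply: (le_trans (sum_eps _ _)); rewrite expr0; lra.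
Qed.

Lemma ex_avg (F : signs m -> T -> R) : (forall t, adm e (F t)) ->
  ex e (fun w => avg (fun t => F t w)) = avg (fun t => ex e (F t)).
Proof.
move=> aF; rewrite /avg mulrC -ex_sum// -exZ; last exact: adm_sum.
by congr ex; apply/funext => w; rewrite mulrC.
Qed.

Lemma adm_avg (F : signs m -> T -> R) : (forall t, adm e (F t)) ->
  adm e (fun w => avg (fun t => F t w)).
Proof. by move=> aF; apply: admM; [exact: adm_sum|exact: adm_cst]. Qed.

Variables (a : nat -> R) (k : nat).
Hypothesis k_gt0 : (0 < k)%N.
Let S w := \sum_(i < m) a i * phi i w.
Let Rm t := \sum_(i < m) a i * sgn i t.
Let p := avg (fun t => Rm t ^+ k.*2).

Lemma adm_S : adm e S.
Proof. by apply: adm_sum => i; exact: admZ. Qed.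

Let p_ge0 : 0 <= p.
Proof. by apply: avg_ge0 => t; exact: even_expr_ge0. Qed.

(** Jensen is applied over the signs at a fixed point [w]. The signs being finite in number,
    exchanging expectations is linearity, and [ex_Q_le2] bounds the kernel for each sign pattern. *)
Lemma moment_le_rademacher :
  ex e (fun w => S w ^+ k.*2) <= 2 * D ^+ k.*2 * p.
Proof.
have aQR t : adm e (fun w => Q t m w * Rm t ^+ k.*2).
  by apply: admM => //; exact: adm_cst.
apply: (@le_trans _ _ (D ^+ k.*2 * ex e (fun w => avg (fun t => Q t m w * Rm t ^+ k.*2)))).
  rewrite -exZ; last exact: adm_avg.
  apply: ler_ex => [||w]; [by apply: admX; exact: adm_S|by apply: admZ; exact: adm_avg|].
  have := @sum_expr_le_avg_riesz _ m a (fun i => phi i w / D) k k_gt0 (c_le1 w).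
  move=> /(ler_wpM2l (exprn_ge0 k.*2 (ltW D0))); congr (_ <= _).
  rewrite -exprMn mulr_sumr; congr (_ ^+ _); apply: eq_bigr => i _.
  by field; rewrite gt_eqF.
rewrite [leRHS]mulrAC mulrC ler_wpM2r ?exprn_ge0 ?(ltW D0)//.
rewrite ex_avg// -avgZ; apply: ler_avg => t.
rewrite (_ : (fun w => _) = fun w => Rm t ^+ k.*2 * Q t m w); last first.
  by apply/funext => w; rewrite mulrC.
by rewrite exZ// mulrC ler_wpM2r ?even_expr_ge0.
Qed.

Let Y t := ex e (fun w => S w * Q t m w).

(** For fixed signs, Jensen with the weight [Q t m] of mass at most 2; then, at each [w], the weight
    averages to 1 over the signs. *)
Let avg_Y : avg (fun t => Y t ^+ k.*2) <= 2 ^+ k.*2 * ex e (fun w => S w ^+ k.*2).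
Proof.
have aQS t : adm e (fun w => Q t m w * S w ^+ k.*2).
  by apply: admM => //; apply: admX; exact: adm_S.
have S2k0 : 0 <= ex e (fun w => S w ^+ k.*2).
  by apply: ex_ge0 => [|w]; [apply: admX; exact: adm_S|exact: even_expr_ge0].
suff : avg (fun t => 2 * (Y t / 2) ^+ k.*2) <= ex e (fun w => S w ^+ k.*2).
  rewrite avgZ.
  under eq_avg do rewrite expr_div_n mulrC.
  rewrite avgZ => le1.
  have k2 : 0 < 2 ^+ k.*2 :> R by rewrite exprn_gt0.
  rewrite -ler_pdivrMl//; lra.
apply: (@le_trans _ _ (avg (fun t => ex e (fun w => Q t m w * S w ^+ k.*2)))).
  apply: ler_avg => t.
  have := jensen_even_weight e (Q t m) S 2 k k_gt0 (ltr0n R 2) (adm_Q t m) adm_S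
    (Q_ge0 t m) (ex_Q_le2 t).
  by congr (_ * (_ / _) ^+ _ <= _); congr ex; apply/funext => w; rewrite mulrC.
rewrite -ex_avg//; apply: ler_ex => [||w].
- exact: adm_avg.
- by apply: admX; exact: adm_S.
under eq_avg do rewrite mulrC.
rewrite avgZ (_ : avg _ = 1) ?mulr1//.
exact: (avg_riesz (fun i => phi i w / D)).
Qed.

(** In the expansion of E (phi_j Q_m), [A] gathers the starting value at index j and the increments
    above j. The increment at j is (s_j / D) E (phi_j^2 Q_j), which telescopes down to E phi_j^2 = 1
    through the terms [c i j]. *)
Let A t j := ex e (fun w => phi j w * Q t j w) +
  \sum_(j.+1 <= i < m) s t i / D * ex e (fun w => phi i w * (phi j w * Q t i w)).
Let c i j t := ex e (fun w => phi i w * (phi j w ^+ 2 * Q t i w)).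

Let A_le t j : (j < m)%N -> D * `|A t j| <= (4 ^+ j)^-1 / 6.
Proof.
move=> jm; apply: le_trans (sum_eps j m); rewrite ler_pM2l// big_ltn//.
have [h1 h2 _] := phi_Q (s t) (sP t).
apply: (le_trans (ler_normD _ _)); apply: lerD; first exact: h1.
apply: (le_trans (ler_norm_sum _ _ _)); rewrite [leLHS]big_nat [leRHS]big_nat.
apply: ler_sum => i /andP[ji _].
rewrite normrM normrM s_norm mul1r -[leRHS]mul1r.
apply: ler_pM => //; last exact: h2.
by rewrite normfV gtr0_norm// invf_le1.
Qed.

(* Telescoping the Riesz product around its factor of index j. *)
Let Y_expand t : Rm t = D * Y t - D * (\sum_(j < m) a j * A t j) -
  \sum_(i < m) s t i / D * \sum_(i.+1 <= j < m) a j * c i j t * s t j.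
Proof.
have YE : Y t = \sum_(j < m) a j * (A t j + s t j / D *
    (1 + \sum_(0 <= i < j) s t i / D * c i j t)).
  rewrite /Y (_ : (fun w => _) = fun w => \sum_(j < m) a j * (phi j w * Q t m w)).
    rewrite ex_sum; last by move=> j; apply: admZ; exact: admM.
    apply: eq_bigr => j _; rewrite exZ; last exact: admM.
    congr (_ * _); rewrite (ex_Q_telescope t (phi j) j m)//; last exact: ltnW.
    rewrite big_ltn// /A addrA addrAC; congr (_ + _); congr (_ * _).
    have := ex_Q_telescope t (fun w => phi j w ^+ 2) 0 j (admX e _ 2 (adm_phi j)) (leq0n j).
    rewrite (_ : (fun w => _ * Q t j w) = fun w => phi j w * (phi j w * Q t j w)); last first.
      by apply/funext => w; rewrite expr2 mulrA.
    move=> ->; congr (_ + _).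
    rewrite -(phi_sqr j); congr ex; apply/funext => w.
    by rewrite /Q /riesz big_ord0 mulr1.
  by apply/funext => w; rewrite /S mulr_suml; apply: eq_bigr => j _; rewrite mulrA.
have swap : \sum_(i < m) s t i / D * (\sum_(i.+1 <= j < m) a j * c i j t * s t j) =
    \sum_(j < m) a j * s t j * \sum_(0 <= i < j) s t i / D * c i j t.
  under eq_bigr do rewrite mulr_sumr.
  rewrite (sum_triangle (fun i j => s t i / D * (a j * c i j t * s t j))).
  apply: eq_bigr => j _; rewrite mulr_sumr; apply: eq_bigr => i _; ring.
rewrite swap YE [D * _]mulr_sumr [D * \sum_(j < m) a j * A t j]mulr_sumr -!sumrB.
by apply: eq_bigr => j _; rewrite -/(s t j); field; rewrite gt_eqF.
Qed.

(* The points of the convex combination with weights 2^-(n+1) that represents [Rm]. *)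
Let x t n := match n with
  | 0 => 2 * D * Y t
  | 1 => - (4 * D) * \sum_(j < m) a j * A t j
  | i.+2 => - 2 ^+ i.+3 * (s t i / D * \sum_(i.+1 <= j < m) a j * c i j t * s t j)
  end.

Let Rm_convex t : Rm t = \sum_(n < m.+2) (2 ^+ n.+1)^-1 * x t n.
Proof.
rewrite 2!big_ord_recl /= Y_expand -addrA; congr (_ + _).
  by rewrite expr1; field.
congr (_ + _); first by rewrite expr2; field.
rewrite -sumrN; apply: eq_bigr => i _; rewrite mulNr mulrN mulrA mulVf ?mul1r//.
Qed.

(** Contraction to the single coefficient a_u gives |a_u|^2k <= p. *)
Let max_a : exists2 M, forall j, (j < m)%N -> `|a j| <= M & 0 <= M /\ M ^+ k.*2 <= p.
Proof.
suff : forall u, (u <= m)%N ->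
    exists2 M, forall j, (j < u)%N -> `|a j| <= M & 0 <= M /\ M ^+ k.*2 <= p.
  by apply.
elim=> [|u IH] um.
  by exists 0 => //; split=> //; rewrite expr0n double_eq0 gtn_eqF.
have [M Ma [M0 Mp]] := IH (ltnW um).
have ap : `|a u| ^+ k.*2 <= p.
  pose b j (_ : signs m) := if j == u then a j else 0.
  have h := @avg_contraction_full R m b a 0 k (leq0n m) _ _.
  apply: (le_trans _ (h _ _)) => //; last first.
    by move=> j t; rewrite /b; case: ifP; rewrite ?normr0.
  rewrite -normrX ger0_norm ?even_expr_ge0// -[leLHS](@avg_cst R m).
  apply: ler_avg => t; rewrite big_mkord (bigD1 (Ordinal um))//= big1.
    by rewrite addr0 /b eqxx exprMn sgn_even mulr1.
  by move=> j ju; rewrite /b -[_ == u]/(j == Ordinal um) (negbTE ju) mul0r.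
have [Mu|uM] := leP M `|a u|.
  exists `|a u| => // j; rewrite ltnS leq_eqVlt => /predU1P[->//|ju].
  exact: le_trans (Ma _ ju) Mu.
exists M => // j; rewrite ltnS leq_eqVlt => /predU1P[->|ju]; first exact: ltW.
exact: Ma.
Qed.

Let x1_le : avg (fun t => x t 1 ^+ k.*2) <= p.
Proof.
have [M Ma [M0 Mp]] := max_a.
rewrite -[leRHS](@avg_cst R m); apply: ler_avg => t; apply: le_trans Mp.
rewrite -[leLHS]ger0_norm ?even_expr_ge0// normrX; apply: lerXn2r; rewrite ?nnegrE//.
rewrite /= mulNr normrN normrM gtr0_norm ?mulr_gt0//.
apply: (@le_trans _ _ (4 * D * \sum_(j < m) M * `|A t j|)).
  rewrite ler_wpM2l ?mulr_ge0 ?(ltW D0)//.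
  apply: (le_trans (ler_norm_sum _ _ _)); apply: ler_sum => j _.
  by rewrite normrM ler_wpM2r// Ma.
rewrite -mulr_sumr.
have : D * \sum_(j < m) `|A t j| <= 1 / 4.
  rewrite mulr_sumr; apply: (@le_trans _ _ (\sum_(0 <= j < m) (4 ^+ j)^-1 / 6)).
    by rewrite big_mkord; apply: ler_sum => j _; exact: A_le.
  by rewrite -mulr_suml; have := @geometric4_le R 0 m; rewrite expr0; lra.
by move=> /(ler_wpM2l M0); lra.
Qed.

Let c_flip i j l t : (i <= l)%N -> (l <= m)%N -> c i j (flip l t) = c i j t.
Proof.
move=> il lm; rewrite /c; congr ex; apply/funext => w; congr (_ * (_ * _)).
rewrite /Q /riesz; apply: eq_bigr => u _; rewrite /s sgn_flip_neq//.
all: by have := ltn_ord u; lia.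
Qed.

(** The common sign s_i disappears in an even power. What remains is a sum over j > i whose
    coefficients depend only on signs below i, and are at most |a_j| by the choice of [eps]:
    contraction applies. *)
Let xS_le i : (i < m)%N -> avg (fun t => x t i.+2 ^+ k.*2) <= p.
Proof.
move=> im; pose b j t := if (i < j)%N then 2 ^+ i.+3 / D * (a j * c i j t) else 0.
have := @avg_contraction_full R m b a i.+1 k im _ _.
move=> h; apply: (le_trans _ (h _ _)).
- apply: ler_avg => t; rewrite [leLHS](_ : _ = (s t i *
     \sum_(i.+1 <= j < m) b j t * sgn j t) ^+ k.*2).
    by rewrite exprMn sgn_even mul1r.
  rewrite /= mulNr -mul2n !(exprM _ 2) sqrrN; congr ((_ ^+ _) ^+ _).
  rewrite !mulr_sumr; apply: eq_big_nat => j /andP[ij _].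
  by rewrite /b ij -/(s t j); field; rewrite gt_eqF.
- move=> j l t il lm; rewrite /b; case: ifP => // _; congr (_ * (_ * _)).
  by apply: c_flip => //; exact: ltnW.
- move=> j t; rewrite /b; case: ifP => [ij|_]; last by rewrite normr0.
  rewrite mulrCA normrM -[leRHS]mulr1 ler_wpM2l// normrM.
  have [_ _ /(_ _ _ ij) h3] := phi_Q (s t) (sP t).
  rewrite normrM normrX normfV (gtr0_norm D0) ger0_norm//.
  apply: (@le_trans _ _ (2 ^+ i.+3 / D * eps i)).
    by rewrite ler_wpM2l// divr_ge0 ?exprn_ge0// ltW.
  rewrite /eps [leLHS](_ : _ = (2 ^+ i)^-1 / D / D).
    have D1' : D^-1 <= 1 by rewrite invf_le1.
    have D'0 : 0 <= D^-1 by rewrite invr_ge0 ltW.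
    have x0 : 0 <= (2 ^+ i)^-1 :> R by rewrite invr_ge0 exprn_ge0.
    have x1 : (2 ^+ i)^-1 <= 1 :> R.
      by rewrite invf_le1 ?exprn_gt0// exprn_ege1//; lra.
    by apply: mulr_ile1 => //; [exact: mulr_ge0|exact: mulr_ile1].
  rewrite (_ : 4 ^+ i = 2 ^+ i * 2 ^+ i); last by rewrite -exprMn; congr (_ ^+ _); ring.
  by rewrite !exprS; field; rewrite gt_eqF//= expf_neq0.
Qed.

(** The error points have total weight at most 1/2 and moments at most [p], so they cost p / 2; the
    point 2 D Y, of weight 1/2, is bounded by [avg_Y]. *)
Lemma rademacher_le_moment : p <= (4 * D) ^+ k.*2 * ex e (fun w => S w ^+ k.*2).
Proof.
have lam0 n : 0 <= (2 ^+ n.+1)^-1 :> R by rewrite invr_ge0 exprn_ge0.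
have convex : p <= \sum_(n < m.+2) (2 ^+ n.+1)^-1 * avg (fun t => x t n ^+ k.*2).
  under eq_bigr do rewrite -avgZ.
  rewrite -avg_sum; apply: ler_avg => t; rewrite Rm_convex.
  apply: (jensen_even_sum _ (fun n : 'I_m.+2 => (2 ^+ n.+1)^-1)) => //.
  exact: sum_halves_le1.
have rest : \sum_(n < m.+1) (2 ^+ n.+2)^-1 * avg (fun t => x t n.+1 ^+ k.*2) <= 2^-1 * p.
  apply: (@le_trans _ _ (\sum_(n < m.+1) (2 ^+ n.+2)^-1 * p)).
    apply: ler_sum => -[[|n] nm] _; (apply: ler_wpM2l; first exact: lam0).
      exact: x1_le.
    exact: (xS_le n).
  rewrite -mulr_suml ler_wpM2r//.
  have := @sum_halves_le1 R m.+2; rewrite big_ord_recl/= expr1; lra.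
move: convex; rewrite big_ord_recl /= expr1.
rewrite (_ : avg _ = (2 * D) ^+ k.*2 * avg (fun t => Y t ^+ k.*2)); last first.
  by rewrite -avgZ; apply: eq_avg => t; rewrite -exprMn.
have := ler_wpM2l (exprn_ge0 k.*2 (ltW (mulr_gt0 (ltr0n R 2) D0))) avg_Y.
rewrite [leRHS]mulrA -exprMn [2 * D * 2](_ : _ = 4 * D); last ring.
move=> h1 h2; apply: le_trans h1; lra.
Qed.

End Moments.

Theorem theorem3p4 (R : realType) (D : R) :
  exists C : R, 0 < C /\
  forall (d : measure_display) (T : measurableType d) (P : probability T R)
         (f : nat -> T -> R),
    orthonormal_seq P f ->
    (forall n w, `| f n w | <= D) ->
    exists sigma : nat -> nat,
      (forall i, (sigma i < sigma i.+1)%N) /\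
      equiv_dist_rademacher P (fun i => f (sigma i)) C.
Proof.
(* The constant is fixed before any sequence is given, hence the maximum with 1; for an actual
   sequence, second moments equal to 1 force 1 <= D. *)
pose D' := Num.max D 1; pose A := 4 * D'; pose B := 4 * A ^+ 4.
have D'1 : 1 <= D' by rewrite /D' le_max lexx orbT.
have A1 : 1 <= A by rewrite /A; lra.
have A41 : 1 <= A ^+ 4 by rewrite exprn_ege1.
have B4 : 4 <= B by rewrite /B; lra.
have AB : 8 * A * 4 ^+ 2 <= 8 * A * B ^+ 2.
  by rewrite ler_wpM2l//; [lra|apply: lerXn2r; rewrite ?nnegrE//; lra].
pose C := 8 * A * B ^+ 2.
have C0 : 0 < C by rewrite /C !mulr_gt0 ?exprn_gt0//; lra.
exists C; split=> // d T P f [mf orth] fD.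
have fD' n w : `|f n w| <= D' by rewrite (le_trans (fD n w))// /D' le_max lexx.
pose e := P_expectation P.
have adm_f n : adm e (f n) by split; [exact: mf|exists D].
have f_orth n m : ex e (fun w => f n w * f m w) = (n == m)%:R.
  by rewrite /e /= /Rintegral orth.
pose eps n : R := (4 ^+ n)^-1 / (8 * D').
have eps_gt0 n : 0 < eps n.
  by rewrite divr_gt0 ?invr_gt0 ?exprn_gt0//; lra.
have [sigma [incr phi_Q]] :=
  almost_multiplicative_subsequence e f D' adm_f f_orth D'1 fD' eps eps_gt0.
exists sigma; split=> //; split=> // m a z z0.
pose phi i := f (sigma i); pose S w := \sum_(i < m) a i * phi i w.
pose r (t : signs m) : R := \sum_(i < m) a i * sgn i t.
have adm_phi n : adm e (phi n) by exact: adm_f.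
have phi_sqr n : ex e (fun w => phi n w ^+ 2) = 1.
  by rewrite -[LHS]/(ex e (fun w => phi n w * phi n w)) f_orth eqxx.
have aS : adm e S by exact: adm_S.
have upper k : (0 < k)%N -> ex e (fun w => S w ^+ k.*2) <=
    A ^+ k.*2 * avg (fun t => r t ^+ k.*2).
  move=> k0; apply: (le_trans (moment_le_rademacher e phi D' adm_phi D'1
    (fun n w => fD' (sigma n) w) phi_Q a k k0)).
  apply: ler_wpM2r; first by apply: avg_ge0 => t; exact: even_expr_ge0.
  rewrite /A exprMn ler_wpM2r//; first by rewrite exprn_ge0//; lra.
  case: k k0 => // k _; rewrite doubleS exprS.
  have : 1 <= 4 ^+ k.*2.+1 :> R by rewrite exprn_ege1//; lra.
  lra.
have lower k : (0 < k)%N -> avg (fun t => r t ^+ k.*2) <=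
    A ^+ k.*2 * ex e (fun w => S w ^+ k.*2).
  move=> k0; exact: (rademacher_le_moment e phi D' adm_phi phi_sqr D'1
    (fun n w => fD' (sigma n) w) phi_Q a k k0).
(* Pass to [r] by [upper], apply hypercontractivity, return by [lower]: the factors A^4k, 4^2k and
   (A^2k)^2 multiply to (4 A^4)^2k, whence [B]. *)
have hyper k : (0 < k)%N -> ex e (fun w => S w ^+ k.*2.*2) <=
    B ^+ k.*2 * ex e (fun w => S w ^+ k.*2) ^+ 2.
  move=> k0; apply: (le_trans (upper k.*2 _)); first by rewrite double_gt0.
  have p0 : 0 <= avg (fun t => r t ^+ k.*2).
    by apply: avg_ge0 => t; exact: even_expr_ge0.
  have p2 : avg (fun t => r t ^+ k.*2) ^+ 2 <=
      (A ^+ k.*2 * ex e (fun w => S w ^+ k.*2)) ^+ 2.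
    apply: lerXn2r; rewrite ?nnegrE//; last exact: lower.
    exact: le_trans p0 (lower k k0).
  have Ak : 0 <= A ^+ k.*2.*2 by rewrite exprn_ge0//; lra.
  have k4 : 0 <= 4 ^+ k.*2 :> R by rewrite exprn_ge0.
  apply: (le_trans (ler_wpM2l Ak (avg_hypercontractive a k))).
  apply: (le_trans (ler_wpM2l Ak (ler_wpM2l k4 p2))).
  rewrite le_eqVlt; apply/orP; left; apply/eqP.
  have -> : B ^+ k.*2 = 4 ^+ k.*2 * (A ^+ k.*2) ^+ 4 by rewrite exprMn exprAC.
  have -> : A ^+ k.*2.*2 = (A ^+ k.*2) ^+ 2 by rewrite -exprM muln2.
  by move: (A ^+ _) (4 ^+ _) (ex _ _) => y1 y2 y3; ring.
have S0 (u : R) : 0 <= u -> seq_tail P phi m a u = (tail e S u)%:E.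
  by move=> u0; rewrite /seq_tail P_tailE.
have Cz0 : 0 <= C * z by rewrite mulr_ge0// ltW.
have Cz0' : 0 <= C^-1 * z by rewrite mulr_ge0 ?invr_ge0// ltW.
rewrite -/phi (S0 _ Cz0) (S0 _ Cz0') rad_tailE//; split.
  (* Paley-Zygmund is applied to [r] here, with loss 4, and to [S] in the other direction, with the
     larger loss [B] that dictates [C]. *)
  rewrite -EFinM lee_fin ler_pdivrMl//.
  apply: (tail_le_of_moments _ _ _ e sign_expectation S r A 4 C) => //.
  - by lra.
  - by move=> k _; exact: avg_hypercontractive.
rewrite -EFinM lee_fin -[X in tail _ _ X <= _](mulVKf (lt0r_neq0 C0)).
apply: (tail_le_of_moments _ _ _ sign_expectation e r S A B C) => //.
- by lra.
- by rewrite mulr_gt0 ?invr_gt0.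
Qed.
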